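(* Let $M=\{M_i\}_{i=1,\dots,m}$ be a family of real analytic totally real $n$-submanifolds of $(\mathbb C^n,0)$ passing through the origin, with pairwise distinct tangent spaces at $0$, $M_i$ being the fixed point set of the anti-holomorphic involution $\rho_i(z)=B_i\bar z+R_i(\bar z)$. Let $G$ be the group generated by $F_{i,j}=\rho_i\circ\rho_j$, $1\le i,j\le m$, and let $D_{i,j}=B_i\bar B_j$ be the linear part of $F_{i,j}$ at $0$. Assume that $G$ is abelian and that all $D_{i,j}=\mathrm{diag}(\mu_{i,j,1},\dots,\mu_{i,j,n})$ are diagonal. Assume that the family $M$ is non-resonant, that $G$ is formally linearizable and that $D=\{D_{i,j}\}$ is diophantine. Then, in a good holomorphic coordinate system at the origin, $M$ is composed of linear totally real subspaces $$\bigcup_i\{z\in\mathbb C^n\mid B_i\bar z=z\},$$ i.e. each $M_i$ becomes $\{B_i\bar z=z\}$.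
   Context: Each $R_i$ is a germ of holomorphic map at $0$ with $R_i(0)=0$, $DR_i(0)=0$; $B_i$ is an invertible matrix with $B_i\bar B_i=\mathrm{Id}$; and $\rho_i\circ\rho_i=\mathrm{Id}$. The tangent space of $M_i$ at $0$ is $\{z=B_i\bar z\}$. All sets are understood as germs at the origin. For $Q\in\mathbb N^n$: $|Q|=q_1+\dots+q_n$, $\mu_{i,j}^Q=\mu_{i,j,1}^{q_1}\cdots\mu_{i,j,n}^{q_n}$, and $\bar\mu_{i,j}^Q$ is its complex conjugate. $M$ is non-resonant if for all $1\le i\le m$, $1\le k\le n$ and all $Q\in\mathbb N^n$ with $|Q|\ge2$, there exists $1\le j\le m$ such that $\bar\mu_{i,j}^Q\ne\mu_{i,j,k}^{-1}$. For $k\ge1$, $\omega_k(D)=\inf\{\max_{1\le i,j\le m}|\mu_{i,j}^Q-\mu_{i,j,s}|\ne0\mid 2\le|Q|\le2^k,\ 1\le s\le n,\ Q\in\mathbb N^n\}$; $D$ is diophantine if $-\sum_{k\ge1}\frac{\ln\omega_k(D)}{2^k}<+\infty$. $G$ is formally linearizable if there is a formal diffeomorphism $\hat\Phi$ of $(\mathbb C^n,0)$, tangent to the identity at $0$, such that $\hat\Phi\circ F_{i,j}\circ\hat\Phi^{-1}(z)=D_{i,j}z$ for all $i,j$. *)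

(* Defs.v *)
From mathcomp Require Import all_boot all_order all_algebra.
From mathcomp Require Import complex mpoly.
From mathcomp Require Import all_classical all_reals all_analysis.

Set Implicit Arguments.
Unset Strict Implicit.
Unset Printing Implicit Defensive.

Import Order.TTheory GRing.Theory Num.Theory.
Import numFieldNormedType.Exports.

Local Open Scope classical_set_scope.
Local Open Scope ring_scope.

(* R[i] itself carries no topology in the library; seen as an abstract
   numClosedFieldType it inherits the one induced by its norm, and so do the
   matrix types over it. *)
Definition Cx (R : realType) : numClosedFieldType := R[i].

(** Power series in n variables, given by their coefficients.  Multi-indices
    are the multinomials 'X_{1..n}; mdeg Q is |Q|, 'U_(l) (i.e. mnm1 l) is the
    l-th unit multi-index and mmap1 x Q is the monomial x^Q. *)

Section PowerSeries.
Variables (K : numFieldType) (n : nat).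
Implicit Types (a : 'X_{1..n} -> K) (z : 'cV[K]_n).

(* sum of the terms of total degree < d *)
Definition ps_trunc (d : nat) a : {mpoly K[n]} :=
  \sum_(Q : 'X_{1..n < d}) a Q *: 'X_[Q].

Definition ps_abs_converges a z : Prop :=
  exists B : K, forall d,
    \sum_(Q : 'X_{1..n < d}) `|a Q * mmap1 (z^~ 0) Q| <= B.

Definition ps_expansion (f : 'cV[K]_n -> K) a : Prop :=
  \forall z \near (0 : 'cV[K]_n),
    ps_abs_converges a z /\
    (fun d => (ps_trunc d a).@[z^~ 0]) @ \oo --> f z.

Definition taylor_series p (f : 'cV[K]_n -> 'cV[K]_p)
    (A : 'I_p -> 'X_{1..n} -> K) : Prop :=
  forall k : 'I_p, ps_expansion (fun z => f z k 0) (A k).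

(* Holomorphic germ when K is the complex field, real analytic germ when K is
   the real field: near 0 each component is the sum of an absolutely convergent
   power series.  Values of f away from 0 are irrelevant. *)
Definition analytic_germ p (f : 'cV[K]_n -> 'cV[K]_p) : Prop :=
  exists A, taylor_series f A.

Definition germ_eq (f g : 'cV[K]_n -> 'cV[K]_n) : Prop :=
  \forall z \near (0 : 'cV[K]_n), f z = g z.

Definition inverse_germs (f g : 'cV[K]_n -> 'cV[K]_n) : Prop :=
  germ_eq (f \o g) id /\ germ_eq (g \o f) id.

(** Formal self-maps of (K^n, 0) *)

Definition fmap0 (f : 'I_n -> 'X_{1..n} -> K) : Prop :=
  forall k, f k (@mnm0 n) = 0.

(* The coefficient of X^Q in f o g only involves the terms of degree at most
   |Q| of f and g, provided g has no constant term (fmap0 g). *)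
Definition fcomp (f g : 'I_n -> 'X_{1..n} -> K) (k : 'I_n) (Q : 'X_{1..n}) : K :=
  let t := ps_trunc (mdeg Q).+1 in
  (t (f k) \mPo [tuple t (g l) | l < n])@_Q.

Definition flin (A : 'M[K]_n) (k : 'I_n) (Q : 'X_{1..n}) : K :=
  \sum_(l < n) A k l * (Q == mnm1 l)%:R.

Definition tangent_to_id (f : 'I_n -> 'X_{1..n} -> K) : Prop :=
  fmap0 f /\ forall k l, f k (mnm1 l) = (k == l)%:R.

(* the group of germs generated by the germs F i j *)
Inductive generated_group (I : Type) (F : I -> I -> 'cV[K]_n -> 'cV[K]_n) :
    ('cV[K]_n -> 'cV[K]_n) -> Prop :=
| gg_gen i j : generated_group F (F i j)
| gg_id : generated_group F id
| gg_comp f g : generated_group F f -> generated_group F g ->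
    generated_group F (f \o g)
| gg_inv f g : generated_group F f -> inverse_germs f g -> generated_group F g.

Definition abelian_germs (G : ('cV[K]_n -> 'cV[K]_n) -> Prop) : Prop :=
  forall f g, G f -> G g -> germ_eq (f \o g) (g \o f).

End PowerSeries.

Section TotallyReal.
Variables (R : realType) (n : nat).
Notation C := (Cx R).

Definition conjv (z : 'cV[C]_n) : 'cV[C]_n := map_mx Num.conj z.

(* C^n = R^n + i R^n *)
Definition realify (z : 'cV[C]_n) : 'cV[R]_(n + n) :=
  col_mx (map_mx (@complex.Re R) z) (map_mx (@complex.Im R) z).

Definition totally_real_subspace (T : set 'cV[C]_n) : Prop :=
  [/\ T 0,
      forall (t : R) u v, T u -> T v -> T ((t%:C)%C *: u + v) &
      forall z, T z -> T ('i *: z) -> z = 0].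

(* tangent space at p of the level set of r through p *)
Definition level_tangent (r : 'cV[R]_(n + n) -> 'cV[R]_n) (p : 'cV[C]_n) :
    set 'cV[C]_n :=
  [set u | 'd r (realify p) (realify u) = 0].

(* The germ at 0 of M is a real analytic, totally real submanifold of C^n of
   real dimension n, passing through 0, with tangent space T at 0: it is given
   by n real analytic equations with independent differentials. *)
Definition totally_real_submanifold (M T : set 'cV[C]_n) : Prop :=
  exists r : 'cV[R]_(n + n) -> 'cV[R]_n,
    [/\ analytic_germ r,
        r 0 = 0 /\ \forall z \near (0 : 'cV[C]_n), M z <-> r (realify z) = 0,
        forall y, exists x, 'd r 0 x = y,
        \forall p \near (0 : 'cV[C]_n),
          M p -> totally_real_subspace (level_tangent r p) &
        T = level_tangent r 0].

Definition linear_fix (B : 'M[C]_n) : set 'cV[C]_n :=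
  [set z | B *m conjv z = z].

Definition antiholo_map (B : 'M[C]_n) (H : 'cV[C]_n -> 'cV[C]_n)
    (z : 'cV[C]_n) : 'cV[C]_n :=
  B *m conjv z + H (conjv z).

End TotallyReal.

Section Family.
Variables (R : realType) (m n : nat).
Notation C := (Cx R).
Implicit Types mu : 'I_m -> 'I_m -> 'rV[C]_n.

Definition nonresonant mu : Prop :=
  forall (i : 'I_m) (k : 'I_n) (Q : 'X_{1..n}), (2 <= mdeg Q)%N ->
    exists j : 'I_m, (mmap1 (mu i j 0) Q)^* != (mu i j 0 k)^-1.

Definition small_divisor mu (Q : 'X_{1..n}) (s : 'I_n) : R :=
  \big[Num.max/0]_(i < m) \big[Num.max/0]_(j < m)
    complex.Re `|mmap1 (mu i j 0) Q - mu i j 0 s|.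

Definition omega mu (k : nat) : R :=
  inf [set x | x != 0 /\ exists (Q : 'X_{1..n}) (s : 'I_n),
                 (2 <= mdeg Q <= 2 ^ k)%N /\ x = small_divisor mu Q s].

Definition diophantine mu : Prop :=
  (- (\sum_(1 <= k <oo) (ln (omega mu k) / 2 ^+ k)%:E) < +oo)%E.

Definition formally_linearizable
    (F : 'I_m -> 'I_m -> 'cV[C]_n -> 'cV[C]_n) (D : 'I_m -> 'I_m -> 'M[C]_n) :
    Prop :=
  exists Phi Psi : 'I_n -> 'X_{1..n} -> C,
    [/\ tangent_to_id Phi, fmap0 Psi,
        fcomp Phi Psi =2 flin 1%:M, fcomp Psi Phi =2 flin 1%:M &
        forall i j, exists2 a, taylor_series (F i j) a &
          fcomp (fcomp Phi a) Psi =2 flin (D i j)].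

End Family.

(* Main.v *)
(* Since [D i j] is conjugated by [B i] to the inverse of its complex conjugate,
   the non-resonance of M says that the family D has no resonance at all.  Hence
   the coefficients psi of the inverse of the formal linearization solve
   (mu^Q - mu_s) psi_(s,Q) = [f(psi)]_(s,Q), where for each (Q, s) the pair (i, j)
   is chosen so as to maximize |mu_(i,j)^Q - mu_(i,j,s)|.  This is Siegel's
   recursion.  As in Brjuno's proof, two indices Q' < Q with a small divisor at
   scale k for the same s satisfy |Q - Q'| >= 2^k, so at most 2 |Q| / 2^k divisors
   of that scale occur in any term of the expanded recursion, and the diophantine
   condition bounds their product by a geometric sequence in |Q|.  The
   same recursion without divisors bounds the inverse series.  In the resulting
   coordinates, rho_i becomes w |-> L_i(conj w) with
   L_i(conj(D_(i,j)) w) = L_j w = D_(j,i) L_i(w), and non-resonance leaves only the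
   linear part B_i of L_i. *)
Require Import Defs.
From mathcomp Require Import all_boot all_order all_algebra.
From mathcomp Require Import perm complex mpoly zify ring lra.
From mathcomp Require Import all_classical all_reals all_analysis.
Import Order.TTheory GRing.Theory Num.Theory.
Import numFieldNormedType.Exports.
Local Open Scope classical_set_scope.
Local Open Scope ring_scope.

Set Implicit Arguments.
Unset Strict Implicit.
Unset Printing Implicit Defensive.

(** * Formal composition *)

(** Small divisors are carried by two weights: [e Q] bounds, for every component, one inverse
    divisor at [Q], and [E] satisfies [e (P + Q) * (E P * E Q) <= E (P + Q)], so that [E Q]
    dominates the product of the weights [e] over every binary splitting of [Q]. Dividing the
    unknown coefficients by [E] makes the recursion divisor-free, and an ordinary majorant argument
    on a small polydisc then suffices. [E] is the exponential of a superadditive count, made for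
    each scale and each component [s] separately, because the gap between small divisors holds only
    for a fixed [s]; the price is a harmless factor [n] in the exponent.

    The hypotheses mix germs, differentials and formal series. The link between them is [geo]:
    Cauchy estimates together with a geometric rate of approximation by truncations, with explicit
    constants. It makes sense over any [numFieldType], is stable under composition and determines
    the coefficients. Completeness of the complex field serves only to pass from coefficient bounds
    back to functions. *)

Section Truncation.
Variables (K : numFieldType) (n : nat).
Implicit Types (p q r : {mpoly K[n]}) (d e : nat) (Q : 'X_{1..n}).
Implicit Types (lq lr : n.-tuple {mpoly K[n]}).
Implicit Types (a b : 'X_{1..n} -> K).

Lemma mcoeff_bsum d a Q :
  (\sum_(P : 'X_{1..n < d}) a P *: 'X_[P])@_Q = if (mdeg Q < d)%N then a Q else 0.
Proof.
rewrite raddf_sum /=; case: ifPn => [ltQd|].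
  rewrite (bigD1 (BMultinom ltQd)) //= mcoeffZ mcoeffX eqxx mulr1.
  rewrite big1 ?addr0 // => P neP; rewrite mcoeffZ mcoeffX.
  by rewrite -(inj_eq val_inj) /= in neP; rewrite (negPf neP) mulr0.
rewrite -leqNgt => leQ; apply: big1 => P _.
rewrite mcoeffZ mcoeffX; case: eqP => [eP|]; last by rewrite mulr0.
by have := bmdeg P; rewrite eP ltnNge leQ.
Qed.

Lemma mcoeff_ps_trunc d a Q :
  (ps_trunc d a)@_Q = if (mdeg Q < d)%N then a Q else 0.
Proof. exact: mcoeff_bsum. Qed.

Lemma eq_ps_trunc d a b :
  (forall Q, (mdeg Q < d)%N -> a Q = b Q) -> ps_trunc d a = ps_trunc d b.
Proof. by move=> ab; apply: eq_bigr => Q _; rewrite ab ?bmdeg. Qed.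

(** Congruence modulo the [d]-th power of the ideal generated by the variables; identities between
    formal series are checked on truncations modulo this relation. *)
Definition eqd d p q := forall Q, (mdeg Q < d)%N -> p@_Q = q@_Q.

Lemma eqd_sym d p q : eqd d p q -> eqd d q p.
Proof. by move=> pq Q /pq. Qed.

Lemma eqd_ps_trunc d e a : (d <= e)%N -> eqd d (ps_trunc e a) (ps_trunc d a).
Proof.
by move=> de Q dQ; rewrite !mcoeff_ps_trunc dQ (leq_trans dQ de).
Qed.

Lemma eqdM d p p' q qq : eqd d p p' -> eqd d q qq -> eqd d (p * q) (p' * qq).
Proof.
move=> pp' qqq Q dQ; rewrite !mcoeffM; apply: eq_bigr => -[/= k1 k2] /eqP QE.
have := dQ; rewrite {1}QE mdegD => dk.
by rewrite pp' ?qqq //; apply: leq_ltn_trans dk; rewrite ?leq_addr ?leq_addl.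
Qed.

Lemma eqd_prod d (I : Type) (s : seq I) (F G : I -> {mpoly K[n]}) :
  (forall i, eqd d (F i) (G i)) -> eqd d (\prod_(i <- s) F i) (\prod_(i <- s) G i).
Proof.
move=> FG; elim: s => [|i s IH]; rewrite ?big_nil ?big_cons //.
exact: eqdM.
Qed.

Lemma eqdX d p q k : eqd d p q -> eqd d (p ^+ k) (q ^+ k).
Proof. move=> pq; elim: k => [|k IH]; first by rewrite !expr0 => Q _.
by rewrite !exprS; exact: eqdM. Qed.

Lemma eqd_sum d (I : Type) (s : seq I) (P : pred I) (F G : I -> {mpoly K[n]}) :
  (forall i, P i -> eqd d (F i) (G i)) ->
  eqd d (\sum_(i <- s | P i) F i) (\sum_(i <- s | P i) G i).
Proof. by move=> FG Q dQ; rewrite !raddf_sum; apply: eq_bigr => i Pi; exact: FG. Qed.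

Lemma eqdZ d c p q : eqd d p q -> eqd d (c *: p) (c *: q).
Proof. by move=> pq Q dQ; rewrite !mcoeffZ pq. Qed.

Lemma eqd0M d e p q : eqd d p 0 -> eqd e q 0 -> eqd (d + e) (p * q) 0.
Proof.
move=> p0 q0 Q dQ; rewrite mcoeffM mcoeff0 big1 // => -[/= k1 k2] /eqP QE.
have [ltd|] := ltnP (mdeg k1) d; first by rewrite p0 // mcoeff0 mul0r.
have [lte|] := ltnP (mdeg k2) e; first by rewrite q0 // mcoeff0 mulr0.
by move=> h1 h2; move: dQ; rewrite {1}QE mdegD ltnNge leq_add.
Qed.

Lemma eqd0X d p k : eqd d p 0 -> eqd (d * k) (p ^+ k) 0.
Proof.
move=> p0; elim: k => [|k IH]; first by rewrite muln0 => Q.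
by rewrite exprS mulnS; apply: eqd0M.
Qed.

Lemma eqd0_monomial lq Q : (forall i, eqd 1 (tnth lq i) 0) ->
  eqd (mdeg Q) (\prod_(i < n) tnth lq i ^+ Q i) 0.
Proof.
move=> lq0; rewrite mdegE.
elim/big_ind2: _ => [R| d p e q|i _]; first by rewrite ltn0.
  exact: eqd0M.
by have := eqd0X (k := Q i) (lq0 i); rewrite mul1n.
Qed.

Lemma eqd1P p : p@_0%MM = 0 <-> eqd 1 p 0.
Proof.
split=> [p0 Q|->]; rewrite ?mcoeff0 ?mdeg0 //.
by rewrite ltnS leqn0 mdeg_eq0 => /eqP ->.
Qed.

(** Without constant terms in [lq], a monomial of degree at least [d] is sent to a polynomial of
    order at least [d], so the terms where [p] and [q] may differ are invisible below degree [d]. *)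
Lemma eqd_compl d p q lq : (forall i, (tnth lq i)@_0%MM = 0) ->
  eqd d p q -> eqd d (p \mPo lq) (q \mPo lq).
Proof.
move=> lq0 pq; have lq1 i : eqd 1 (tnth lq i) 0 by apply/eqd1P.
suff pq0 : eqd d ((p - q) \mPo lq) 0.
  by move=> Q /pq0; rewrite comp_mpolyB mcoeffB mcoeff0 => /eqP; rewrite subr_eq0 => /eqP.
rewrite comp_mpolyEX => Q dQ; rewrite raddf_sum /= mcoeff0 big1 // => P _.
rewrite comp_mpolyX mcoeffZ.
have [Pd|Pd] := ltnP (mdeg P) d.
  by rewrite mcoeffB pq // subrr mul0r.
by rewrite (eqd0_monomial lq1) ?mcoeff0 ?mulr0 // (leq_trans dQ).
Qed.

Lemma eqd_compr d p lq lr : (forall i, eqd d (tnth lq i) (tnth lr i)) ->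
  eqd d (p \mPo lq) (p \mPo lr).
Proof.
move=> qqq; rewrite !comp_mpolyEX; apply: eqd_sum => P _; apply: eqdZ.
by rewrite !comp_mpolyX; apply: eqd_prod => i; apply: eqdX.
Qed.

Lemma comp_mpoly_sum (I : Type) (s : seq I) (F : I -> {mpoly K[n]}) lq :
  (\sum_(i <- s) F i) \mPo lq = \sum_(i <- s) (F i \mPo lq).
Proof. exact: (raddf_sum (comp_mpoly lq)). Qed.

Lemma comp_mpolyA p lq lr :
  (p \mPo lq) \mPo lr = p \mPo [tuple (tnth lq i \mPo lr) | i < n].
Proof.
rewrite [p \mPo lq]comp_mpolyEX [RHS]comp_mpolyEX comp_mpoly_sum; apply: eq_bigr => P _.
rewrite comp_mpolyZ !comp_mpolyX rmorph_prod; congr (_ *: _).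
by apply: eq_bigr => i _; rewrite rmorphXn /= tnth_mktuple.
Qed.

End Truncation.

Section FormalComposition.
Variables (K : numFieldType) (n : nat).
Implicit Types (Q : 'X_{1..n}) (f g h : 'I_n -> 'X_{1..n} -> K).

Definition pst d g := [tuple ps_trunc d (g l) | l < n].

Lemma pst0 d g : fmap0 g -> forall i, (tnth (pst d g) i)@_0%MM = 0.
Proof. by move=> g0 i; rewrite tnth_mktuple mcoeff_ps_trunc g0 if_same. Qed.

(** Any cutoff above [mdeg Q] yields the same coefficient, so that different coefficients, or nested
    compositions, can share one cutoff. *)
Lemma fcompE d f g k Q : fmap0 g -> (mdeg Q < d)%N ->
  fcomp f g k Q = (ps_trunc d (f k) \mPo pst d g)@_Q.
Proof.
move=> g0 dQ; rewrite /fcomp -/(pst _ _); symmetry.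
have le := eqd_compl (pst0 d g0) (eqd_ps_trunc (f k) dQ).
rewrite [LHS](le _ (ltnSn _)).
by apply: eqd_compr (ltnSn _) => i; rewrite !tnth_mktuple; apply: eqd_ps_trunc.
Qed.

Lemma ps_trunc_fcomp d f g k : fmap0 g ->
  eqd d (ps_trunc d (fcomp f g k)) (ps_trunc d (f k) \mPo pst d g).
Proof. by move=> g0 Q dQ; rewrite mcoeff_ps_trunc dQ (fcompE f k g0 dQ). Qed.

Lemma fmap0_fcomp f g : fmap0 f -> fmap0 g -> fmap0 (fcomp f g).
Proof.
move=> f0 g0 k; rewrite (@fcompE 1) ?mdeg0 // (_ : ps_trunc 1 (f k) = 0).
  by rewrite comp_mpoly0 mcoeff0.
rewrite /ps_trunc big1 // => P _; suff -> : (P : 'X_{1..n}) = 0%MM by rewrite f0 scale0r.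
by apply/eqP; rewrite -mdeg_eq0 -leqn0 -ltnS bmdeg.
Qed.

Lemma fcompA f g h : fmap0 g -> fmap0 h ->
  fcomp (fcomp f g) h =2 fcomp f (fcomp g h).
Proof.
move=> g0 h0 k Q; have gh0 := fmap0_fcomp g0 h0; have dQ := ltnSn (mdeg Q).
rewrite (fcompE _ k h0 dQ) (fcompE _ k gh0 dQ).
have le := eqd_compl (pst0 (mdeg Q).+1 h0) (ps_trunc_fcomp (d := (mdeg Q).+1) f k g0).
rewrite [LHS](le _ dQ) comp_mpolyA.
apply: eqd_compr dQ => i; rewrite !tnth_mktuple; apply: eqd_sym.
exact: ps_trunc_fcomp.
Qed.

Lemma eq_fcomp f f' g g' : f =2 f' -> g =2 g' -> fcomp f g =2 fcomp f' g'.
Proof.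
move=> ff' gg' k Q; rewrite /fcomp.
have -> : ps_trunc (mdeg Q).+1 (f k) = ps_trunc (mdeg Q).+1 (f' k).
  by apply: eq_ps_trunc => P _; exact: ff'.
congr ((_ \mPo _)@_Q); apply: eq_mktuple => l; apply: eq_ps_trunc => P _.
exact: gg'.
Qed.

Lemma fmap0_flin (A : 'M[K]_n) : fmap0 (flin A).
Proof.
move=> k; rewrite /flin big1 // => l _.
by rewrite eq_sym -mdeg_eq0 mdeg1 mulr0.
Qed.

Lemma flin1 (A : 'M[K]_n) k l : flin A k U_(l)%MM = A k l.
Proof.
rewrite /flin (bigD1 l) //= eqxx mulr1 big1 ?addr0 // => j jl.
by rewrite eq_mnm1 eq_sym (negPf jl) mulr0.
Qed.

Lemma flin_ge2 (A : 'M[K]_n) k Q : mdeg Q != 1%N -> flin A k Q = 0.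
Proof.
move=> Q1; rewrite /flin big1 // => l _.
by case: eqP => [QE|]; rewrite ?mulr0 //; rewrite QE mdeg1 in Q1.
Qed.

Lemma ps_trunc_flin d (A : 'M[K]_n) k : (1 < d)%N ->
  ps_trunc d (flin A k) = \sum_l A k l *: 'X_l.
Proof.
move=> d1; apply/mpolyP => Q; rewrite mcoeff_ps_trunc raddf_sum /=.
under eq_bigr do rewrite mcoeffZ mcoeffX eq_sym.
case: ifPn => // Qd; rewrite big1 // => l _.
by case: eqP => [QE|]; rewrite ?mulr0 //; rewrite QE mdeg1 d1 in Qd.
Qed.

Lemma fcompE_lin A g k Q : fmap0 g ->
  fcomp (flin A) g k Q = \sum_l A k l * g l Q.
Proof.
move=> g0; rewrite (@fcompE (mdeg Q).+2) // ps_trunc_flin // comp_mpoly_sum raddf_sum /=.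
apply: eq_bigr => l _.
by rewrite comp_mpolyZ mcoeffZ comp_mpolyXU -tnth_nth tnth_mktuple mcoeff_ps_trunc leqW.
Qed.

Lemma fcomp1f g : fmap0 g -> fcomp (flin 1%:M) g =2 g.
Proof.
move=> g0 k Q; rewrite fcompE_lin // (bigD1 k) //= mxE eqxx mul1r.
rewrite big1 ?addr0 // => l lk.
by rewrite mxE eq_sym (negPf lk) mul0r.
Qed.

(** A diagonal substitution only rescales monomials. The divisors [mu^Q - mu_s] come from here: a
    conjugacy to a diagonal map becomes one scalar equation per coefficient. *)
Lemma fcomp_diag f (mu : 'rV[K]_n) k Q :
  fcomp f (flin (diag_mx mu)) k Q = f k Q * mmap1 (mu 0) Q.
Proof.
rewrite (@fcompE (mdeg Q).+2) //; last exact: fmap0_flin.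
rewrite comp_mpoly_sum raddf_sum /=.
have dQ := leqW (ltnSn (mdeg Q)).
have mon (P : 'X_{1..n}) : \prod_(i < n) tnth (pst (mdeg Q).+2 (flin (diag_mx mu))) i ^+ P i =
   mmap1 (mu 0) P *: 'X_[P].
  rewrite mpolyXE_id -scaler_prod; apply: eq_bigr => i _.
  rewrite -exprZn tnth_mktuple ps_trunc_flin // (bigD1 i) //= !mxE eqxx mulr1n.
  by rewrite big1 ?addr0 // => l li; rewrite mxE eq_sym (negPf li) mulr0n scale0r.
rewrite (bigD1 (BMultinom dQ)) //= comp_mpolyZ comp_mpolyX mon !mcoeffZ mcoeffX.
rewrite eqxx mulr1 big1 ?addr0 // => P neP.
rewrite -(inj_eq val_inj) /= in neP.
by rewrite comp_mpolyZ comp_mpolyX mon !mcoeffZ mcoeffX (negPf neP) !mulr0.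
Qed.

Lemma fcompf1 f : fcomp f (flin 1%:M) =2 f.
Proof.
move=> k Q; rewrite -diag_const_mx fcomp_diag /mmap1 big1 ?mulr1 // => i _.
by rewrite mxE expr1n.
Qed.

Lemma flin_deg1 f k Q : fmap0 f -> (mdeg Q < 2)%N ->
  f k Q = flin (\matrix_(i, j) f i U_(j)%MM) k Q.
Proof.
move=> f0 Q2; have [Q0|Q0] := posnP (mdeg Q).
  by move/eqP: Q0; rewrite mdeg_eq0 => /eqP ->; rewrite f0 fmap0_flin.
have : mdeg Q == 1%N by rewrite eqn_leq Q0 -ltnS Q2.
by move/mdeg1P => [i /eqP ->]; rewrite flin1 mxE.
Qed.

(** The chain rule at the origin. *)
Lemma fcomp_coef1 f g k l : fmap0 f -> fmap0 g ->
  fcomp f g k U_(l)%MM = \sum_j f k U_(j)%MM * g j U_(l)%MM.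
Proof.
move=> f0 g0; pose A := \matrix_(i, j) f i U_(j)%MM.
have -> : fcomp f g k U_(l)%MM = fcomp (flin A) g k U_(l)%MM.
  rewrite !(@fcompE 2) ?mdeg1 //.
  apply: (@eqd_compl _ _ 2); rewrite ?mdeg1 //; first exact: pst0.
  move=> Q Q2; rewrite !mcoeff_ps_trunc Q2; exact: flin_deg1.
by rewrite fcompE_lin //; apply: eq_bigr => j _; rewrite mxE.
Qed.

End FormalComposition.

(** * Majorants and tail estimates *)

Section Majorants.
Variables (K : numFieldType) (n : nat).
Implicit Types (p q : {mpoly K[n]}) (d e : nat) (Q P : 'X_{1..n}).
Implicit Types (lp lq : n.-tuple {mpoly K[n]}).
Implicit Types (a b E : 'X_{1..n} -> K) (u v : 'I_n -> K).

Definition box (rho : K) u := forall i, `|u i| <= rho.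

Lemma mmap1_cst (r : K) Q : mmap1 (fun=> r) Q = r ^+ mdeg Q.
Proof. by rewrite /mmap1 mdegE -prodrXr. Qed.

Lemma norm_mmap1_le (rho : K) u Q : box rho u -> `|mmap1 u Q| <= rho ^+ mdeg Q.
Proof.
move=> bu; rewrite -mmap1_cst /mmap1 normr_prod; apply: ler_prod => i _.
by rewrite normr_ge0 /= normrX lerXn2r ?nnegrE ?(le_trans _ (bu i)).
Qed.

Lemma meval_bsum d a u (C : pred 'X_{1..n < d}) :
  (\sum_(Q : 'X_{1..n < d} | C Q) a Q *: 'X_[Q]).@[u] =
  \sum_(Q : 'X_{1..n < d} | C Q) a Q * mmap1 u Q.
Proof.
by rewrite raddf_sum /=; apply: eq_bigr => Q _; rewrite mevalZ mevalX.
Qed.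

Lemma meval_ps_trunc d a u :
  (ps_trunc d a).@[u] = \sum_(Q : 'X_{1..n < d}) a Q * mmap1 u Q.
Proof. exact: meval_bsum. Qed.

Lemma meval_bmnm d p u : (msize p <= d)%N ->
  p.@[u] = \sum_(Q : 'X_{1..n < d}) p@_Q * mmap1 u Q.
Proof. by move=> pd; rewrite {1}(mpolywE pd); exact: (meval_bsum (fun Q => p@_Q) u). Qed.

Lemma ps_truncB d e a : (d <= e)%N ->
  ps_trunc e a - ps_trunc d a =
  \sum_(Q : 'X_{1..n < e} | (d <= mdeg Q)%N) a Q *: 'X_[Q].
Proof.
move=> de; rewrite big_mkcond; apply/mpolyP => Q.
rewrite mcoeffB !mcoeff_ps_trunc.
rewrite (eq_bigr (fun P : 'X_{1..n < e} =>
  (if (d <= mdeg P)%N then a P else 0) *: 'X_[P])); last first.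
  by move=> P _; case: ifP; rewrite ?scale0r.
rewrite (mcoeff_bsum e (fun P => if (d <= mdeg P)%N then a P else 0)).
have [dQ|dQ] := ltnP (mdeg Q) d.
  by rewrite (leq_trans dQ de) subrr.
by rewrite subr0.
Qed.

Lemma meval_ps_truncB d e a u : (d <= e)%N ->
  (ps_trunc e a).@[u] - (ps_trunc d a).@[u] =
  \sum_(Q : 'X_{1..n < e} | (d <= mdeg Q)%N) a Q * mmap1 u Q.
Proof. by move=> de; rewrite -mevalB ps_truncB // meval_bsum. Qed.

(** The multi-indices embed in a cube, over which the sum factors into [n] geometric sums, each at
    most 2. *)
Lemma sum_half_le d : \sum_(Q : 'X_{1..n < d}) (2^-1 : K) ^+ mdeg Q <= 2 ^+ n.
Proof.
have leQ (Q : 'X_{1..n < d}) i : (Q i < d)%N.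
  by apply: leq_ltn_trans (bmdeg Q); rewrite mdegE (bigD1 i) //= leq_addr.
pose h (Q : 'X_{1..n < d}) : {ffun 'I_n -> 'I_d} := [ffun i => Ordinal (leQ Q i)].
have hinj : injective h.
  move=> Q Q' hQ; apply/val_inj/mnmP => i.
  by have /ffunP/(_ i) := hQ; rewrite !ffunE => -[].
pose F (f : {ffun 'I_n -> 'I_d}) : K := \prod_i 2^-1 ^+ f i.
have -> : \sum_(Q : 'X_{1..n < d}) (2^-1 : K) ^+ mdeg Q =
    \sum_(f in h @: [set: 'X_{1..n < d}]%SET) F f.
  rewrite big_imset /=; last by move=> ? ? _ _; apply: hinj.
  apply: eq_big => [Q|Q _]; first by rewrite inE.
  by rewrite mdegE -prodrXr; apply: eq_bigr => i _; rewrite ffunE.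
have F0 f : 0 <= F f by apply: prodr_ge0 => i _; rewrite exprn_ge0 ?invr_ge0.
apply: (@le_trans _ _ (\sum_f F f)).
  rewrite [leRHS](bigID (mem (h @: [set: 'X_{1..n < d}]%SET))) /=.
  by rewrite lerDl sumr_ge0.
rewrite -(bigA_distr_bigA (fun _ (j : 'I_d) => 2^-1 ^+ j)) /=.
rewrite prodr_const card_ord; apply: lerXn2r; rewrite ?nnegrE //.
  by apply: sumr_ge0 => i _; rewrite exprn_ge0 ?invr_ge0.
rewrite -(big_mkord xpredT (fun j => (2^-1 : K) ^+ j)).
have -> : \sum_(0 <= j < d) (2^-1 : K) ^+ j = 2 - 2 * 2^-1 ^+ d.
  elim: d {leQ h hinj F F0} => [|d IH].
    by rewrite big_geq // expr0 mulr1 subrr.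
  rewrite big_nat_recr //= IH exprS mulrA divff // mul1r mulr_natl mulr2n.
  by rewrite opprD addrA subrK.
by rewrite lerBlDr lerDl mulr_ge0 ?exprn_ge0 ?invr_ge0.
Qed.

(* Each factor [x] is traded for [(2 x) / 2]: the first part gives the decay, the
   second one the summability over all multi-indices. *)
Lemma sum_tail_le d e (x : K) : 0 <= x -> 2 * x <= 1 ->
  \sum_(Q : 'X_{1..n < e} | (d <= mdeg Q)%N) x ^+ mdeg Q <= (2 * x) ^+ d * 2 ^+ n.
Proof.
move=> x0 x1; have y0 : 0 <= 2 * x by rewrite mulr_ge0.
apply: (@le_trans _ _ (\sum_(Q : 'X_{1..n < e} | (d <= mdeg Q)%N)
   (2 * x) ^+ d * 2^-1 ^+ mdeg Q)).
  apply: ler_sum => Q dQ.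
  have {1}-> : x = (2 * x) * 2^-1 by rewrite mulrAC divff ?mul1r.
  rewrite exprMn.
  by rewrite ler_wpM2r ?exprn_ge0 ?invr_ge0 // ler_wiXn2l.
rewrite -mulr_sumr ler_wpM2l ?exprn_ge0 //.
apply: le_trans (sum_half_le e).
rewrite [leRHS](bigID (fun Q : 'X_{1..n < e} => (d <= mdeg Q)%N)) /=.
by rewrite lerDl sumr_ge0 // => Q _; rewrite exprn_ge0 ?invr_ge0.
Qed.

Definition coef_bound (A c : K) a := forall Q, `|a Q| <= A * c ^+ mdeg Q.

Lemma ps_trunc_tail A c a d e rho u : 0 <= A -> 0 <= c -> coef_bound A c a ->
  0 <= rho -> box rho u -> 2 * c * rho <= 1 -> (d <= e)%N ->
  `|(ps_trunc e a).@[u] - (ps_trunc d a).@[u]| <= A * 2 ^+ n * (2 * c * rho) ^+ d.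
Proof.
move=> A0 c0 aAc r0 bu crho de; rewrite meval_ps_truncB //.
apply: le_trans (ler_norm_sum _ _ _) _.
apply: (@le_trans _ _ (\sum_(Q : 'X_{1..n < e} | (d <= mdeg Q)%N)
   A * (c * rho) ^+ mdeg Q)).
  apply: ler_sum => Q _; rewrite normrM exprMn mulrA.
  by apply: ler_pM => //; exact: norm_mmap1_le.
rewrite -mulr_sumr -mulrA ler_wpM2l // [leRHS]mulrC -[2 * c * rho]mulrA.
by apply: sum_tail_le; rewrite ?mulrA // mulr_ge0.
Qed.

(** Majorization after division of the coefficients of [p] by the weight [E]. The cutoff [d] serves
    an induction on the degree; the constant weight 1 gives ordinary majorants. *)
Definition wmaj E d p q := forall Q, (mdeg Q < d)%N -> `|p@_Q| <= E Q * q@_Q.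

Section Weight.
Variable E : 'X_{1..n} -> K.
Hypothesis E_gt0 : forall Q, 0 < E Q.

Lemma wmaj_ge0 d p q Q : wmaj E d p q -> (mdeg Q < d)%N -> 0 <= q@_Q.
Proof.
by move=> pq dQ; rewrite -(pmulr_rge0 _ (E_gt0 Q)) (le_trans _ (pq _ dQ)).
Qed.

Hypothesis E0 : E 0%MM = 1.
Hypothesis E_mul : forall Q P, E Q * E P <= E (Q + P)%MM.

Lemma wmaj1 d : wmaj E d 1 1.
Proof.
move=> Q _; rewrite mcoeff1; case: eqP => [->|]; last by rewrite normr0 mulr0.
by rewrite E0 normr1 mulr1.
Qed.

Lemma wmajM d p p1 q q1 : wmaj E d p q -> wmaj E d p1 q1 ->
  wmaj E d (p * p1) (q * q1).
Proof.
move=> pq pq1 Q dQ; rewrite !mcoeffM mulr_sumr.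
apply: le_trans (ler_norm_sum _ _ _) _; apply: ler_sum => -[/= k1 k2] /eqP QE.
have := dQ; rewrite {1}QE mdegD => dk.
have dk1 : (mdeg k1 < d)%N by apply: leq_ltn_trans dk; rewrite leq_addr.
have dk2 : (mdeg k2 < d)%N by apply: leq_ltn_trans dk; rewrite leq_addl.
rewrite normrM; apply: (@le_trans _ _ (E k1 * q@_k1 * (E k2 * q1@_k2))).
  by apply: ler_pM => //; [apply: pq|apply: pq1].
rewrite mulrACA ler_wpM2r //; last by rewrite {3}QE.
by rewrite mulr_ge0 ?(wmaj_ge0 pq) ?(wmaj_ge0 pq1).
Qed.

Lemma wmajX d p q k : wmaj E d p q -> wmaj E d (p ^+ k) (q ^+ k).
Proof.
move=> pq; elim: k => [|k IH]; first by rewrite !expr0; apply: wmaj1.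
by rewrite !exprS; apply: wmajM.
Qed.

Lemma wmaj_compX d lp lq P : (forall i, wmaj E d (tnth lp i) (tnth lq i)) ->
  wmaj E d ('X_[P] \mPo lp) ('X_[P] \mPo lq).
Proof.
move=> pq; rewrite !comp_mpolyX; elim/big_ind2: _ => [|p q p1 q1|i _].
- exact: wmaj1.
- exact: wmajM.
- exact: wmajX.
Qed.

Lemma wmaj_comp d e a b lp lq : (forall Q, `|a Q| <= b Q) ->
  (forall i, wmaj E d (tnth lp i) (tnth lq i)) ->
  wmaj E d (ps_trunc e a \mPo lp) (ps_trunc e b \mPo lq).
Proof.
move=> ab pq Q dQ; rewrite !comp_mpoly_sum !raddf_sum /= mulr_sumr.
apply: le_trans (ler_norm_sum _ _ _) _; apply: ler_sum => P _.
rewrite !comp_mpolyZ !mcoeffZ normrM mulrCA.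
by apply: ler_pM => //; apply: wmaj_compX.
Qed.

End Weight.

Lemma ncoef_meval_ge0 q (r : K) : (forall Q, 0 <= q@_Q) -> 0 <= r ->
  0 <= q.@[fun=> r].
Proof.
move=> q0 r0; rewrite (meval_bmnm _ (leqnn _)); apply: sumr_ge0 => Q _.
by rewrite mmap1_cst mulr_ge0 ?exprn_ge0.
Qed.

Lemma ncoef_bsum_le q (r : K) d : (forall Q, 0 <= q@_Q) -> 0 <= r ->
  \sum_(Q : 'X_{1..n < d}) q@_Q * r ^+ mdeg Q <= q.@[fun=> r].
Proof.
move=> q0 r0; pose e := maxn d (msize q).
rewrite (@meval_bmnm e) ?leq_maxr //.
under [leRHS]eq_bigr do rewrite mmap1_cst.
have -> : \sum_(Q : 'X_{1..n < d}) q@_Q * r ^+ mdeg Q = (ps_trunc d (fun P => q@_P)).@[fun=> r].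
  by rewrite meval_ps_trunc; apply: eq_bigr => Q _; rewrite mmap1_cst.
have -> : \sum_(Q : 'X_{1..n < e}) q@_Q * r ^+ mdeg Q = (ps_trunc e (fun P => q@_P)).@[fun=> r].
  by rewrite meval_ps_trunc; apply: eq_bigr => Q _; rewrite mmap1_cst.
rewrite -subr_ge0 meval_ps_truncB ?leq_maxl //.
by apply: sumr_ge0 => Q _; rewrite mmap1_cst mulr_ge0 ?exprn_ge0.
Qed.

Definition maj p q := forall Q, `|p@_Q| <= q@_Q.

Lemma maj_ge0 p q : maj p q -> forall Q, 0 <= q@_Q.
Proof. by move=> pq Q; apply: le_trans (pq Q). Qed.

Lemma maj_comp e a b lp lq : (forall Q, `|a Q| <= b Q) ->
  (forall i, maj (tnth lp i) (tnth lq i)) ->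
  maj (ps_trunc e a \mPo lp) (ps_trunc e b \mPo lq).
Proof.
move=> ab pq Q.
rewrite -[leRHS]mul1r; apply: (@wmaj_comp (fun=> 1) _ _ _ (mdeg Q).+1) => //.
by move=> i P _; rewrite mul1r; apply: pq.
Qed.

Lemma ncoef_compX lq P : (forall i Q, 0 <= (tnth lq i)@_Q) ->
  forall Q, 0 <= ('X_[P] \mPo lq)@_Q.
Proof.
move=> lq0 Q; apply: le_trans (normr_ge0 _) _; rewrite -[leRHS]mul1r.
apply: (@wmaj_compX (fun=> 1) _ _ _ (mdeg Q).+1 lq) => // i R _.
by rewrite mul1r ger0_norm.
Qed.

Lemma maj_ps_trunc d a b : (forall Q, `|a Q| <= b Q) ->
  maj (ps_trunc d a) (ps_trunc d b).
Proof.
by move=> ab Q; rewrite !mcoeff_ps_trunc; case: ifP; rewrite ?normr0.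
Qed.

Lemma maj_coef p q (r : K) Q : maj p q -> 0 <= r ->
  `|p@_Q| * r ^+ mdeg Q <= q.@[fun=> r].
Proof.
move=> pq r0; apply: (@le_trans _ _ (q@_Q * r ^+ mdeg Q)).
  by rewrite ler_wpM2r ?exprn_ge0.
apply: le_trans (@ncoef_bsum_le _ _ (mdeg Q).+1 (maj_ge0 pq) r0).
rewrite (bigD1 (BMultinom (ltnSn (mdeg Q)))) //= lerDl sumr_ge0 // => P _.
by rewrite mulr_ge0 ?exprn_ge0 ?(maj_ge0 pq).
Qed.

(** Shrinking the radius from [s] to [rho] gains a factor [rho / s] per degree, hence at least [d]
    such factors on the terms beyond the truncation. *)
Lemma maj_tail p q (rho s : K) u d : maj p q -> 0 <= rho -> 0 < s -> rho <= s ->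
  box rho u ->
  `|p.@[u] - (ps_trunc d (fun P => p@_P)).@[u]| <= (rho / s) ^+ d * q.@[fun=> s].
Proof.
move=> pq r0 s0 rs bu; pose e := maxn d (msize p).
have -> : p.@[u] = (ps_trunc e (fun P => p@_P)).@[u].
  by rewrite meval_ps_trunc -meval_bmnm // leq_maxr.
rewrite meval_ps_truncB ?leq_maxl //.
apply: le_trans (ler_norm_sum _ _ _) _.
apply: (@le_trans _ _ (\sum_(Q : 'X_{1..n < e} | (d <= mdeg Q)%N)
   (rho / s) ^+ d * (q@_Q * s ^+ mdeg Q))).
  apply: ler_sum => Q dQ; rewrite normrM.
  apply: (@le_trans _ _ (q@_Q * rho ^+ mdeg Q)).
    by apply: ler_pM => //; exact: norm_mmap1_le.
  rewrite mulrCA ler_wpM2l ?(maj_ge0 pq) //.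
  have {1}-> : rho = rho / s * s by rewrite divfK ?gt_eqF.
  have rs0 : 0 <= rho / s by rewrite divr_ge0 // ltW.
  rewrite exprMn ler_wpM2r ?exprn_ge0 ?(ltW s0) // ler_wiXn2l //.
  by rewrite ler_pdivrMr // mul1r.
rewrite -mulr_sumr ler_wpM2l ?exprn_ge0 ?divr_ge0 ?(ltW s0) //.
apply: le_trans (@ncoef_bsum_le q s e (maj_ge0 pq) (ltW s0)).
rewrite [leRHS](bigID (fun Q : 'X_{1..n < e} => (d <= mdeg Q)%N)) /=.
by rewrite lerDl sumr_ge0 // => Q _; rewrite mulr_ge0 ?exprn_ge0 ?(maj_ge0 pq) // ltW.
Qed.

End Majorants.

(** * Expansions with a geometric rate *)

Section Germs.
Variables (K : numFieldType) (n : nat).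
Implicit Types (Q P : 'X_{1..n}) (a b : 'X_{1..n} -> K) (z : 'cV[K]_n).
Implicit Types (f : 'cV[K]_n -> K).

Lemma norm_le_box rho z : 0 <= rho -> box rho (z^~ 0) -> `|z| <= rho.
Proof.
move=> r0 bz; have [->//|/mx_norm_neq0 [[i j]]] := eqVneq `|z| 0.
move=> zE; have -> : `|z| = `|z i j| := zE.
by rewrite (ord1 j).
Qed.

Lemma box_norm z : box `|z| (z^~ 0).
Proof.
move=> i; rewrite (_ : `|z| = mx_norm z) // mx_normE -[leLHS]nngE num_le.
exact: (@le_bigmax _ _ _ _ (fun i : 'I_n * 'I_1 => `|z i.1 i.2|%:nng) (i, 0)).
Qed.

Lemma near0_boxP (S : 'cV[K]_n -> Prop) :
  (\forall z \near (0 : 'cV[K]_n), S z) <->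
  exists2 rho, 0 < rho & forall z, box rho (z^~ 0) -> S z.
Proof.
rewrite nbhs_norm0P; split=> -[/= e e0 Se].
  exists (e / 2) => [|z bz]; first by rewrite divr_gt0.
  apply: Se => /=; apply: le_lt_trans (norm_le_box _ bz) _.
    by rewrite ltW // divr_gt0.
  by rewrite ltr_pdivrMr // ltr_pMr // ltr1n.
exists e => // z /= ze; apply: Se => i; apply: ltW.
by apply: le_lt_trans ze; apply: box_norm.
Qed.

Lemma small_le0 (x X C : K) : 0 <= X -> 0 < C ->
  (forall rho, 0 < rho -> C * rho <= 1 -> x <= X * rho) -> x <= 0.
Proof.
move=> X0 C0 H; apply/ler_addgt0Pr => e e0; rewrite add0r.
(* The radius [e / (X + C * e + 1)] ensures both [C * rho <= 1] and [X * rho <= e]. *)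
have D0 : 0 < X + C * e + 1.
  by rewrite addr_gt0 ?addr_ge0 // ltr_wpDl // mulr_gt0.
have r0 : 0 < e / (X + C * e + 1) by rewrite divr_gt0.
apply: le_trans (H _ r0 _) _.
  rewrite mulrA ler_pdivrMr // mul1r -addrA addrCA lerDl.
  by rewrite addr_ge0.
rewrite mulrA ler_pdivrMr // [X * e]mulrC ler_pM2l // -addrA lerDl.
by rewrite addr_ge0 // mulr_ge0 // ltW.
Qed.

(* A quantitative form of [ps_expansion] (see [expansion_geo] and
   [geo_expansion]) that is stable under composition. *)
Definition geo (A c : K) f a := [/\ 0 <= A, 0 < c, coef_bound A c a &
  forall rho z d, 0 <= rho -> c * rho <= 1 -> box rho (z^~ 0) ->
    `|f z - (ps_trunc d a).@[z^~ 0]| <= A * (c * rho) ^+ d].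

Lemma geo_le A c B e f a : A <= B -> c <= e -> geo A c f a -> geo B e f a.
Proof.
move=> AB ce [A0 c0 aAc fT]; split=> [|||rho z d r0 er bz].
- exact: le_trans AB.
- exact: lt_le_trans ce.
- move=> Q; apply: le_trans (aAc Q) _; apply: ler_pM => //.
    by rewrite exprn_ge0 // ltW.
  by rewrite lerXn2r ?nnegrE ?(ltW c0) ?(le_trans (ltW c0)).
have cr : c * rho <= e * rho by rewrite ler_wpM2r.
apply: le_trans (fT rho z d r0 (le_trans cr er) bz) _.
have cr0 : 0 <= c * rho by rewrite mulr_ge0 // ltW.
by apply: ler_pM; rewrite ?exprn_ge0 // lerXn2r ?nnegrE ?(le_trans cr0).
Qed.

Lemma geo_family (I : finType) (f : I -> 'cV[K]_n -> K)
    (a_ : I -> 'X_{1..n} -> K) :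
  (forall k, exists A c, geo A c (f k) (a_ k)) ->
  exists A c, 0 <= A /\ 0 < c /\ forall k, geo A c (f k) (a_ k).
Proof.
move=> H; have /choice [Ac HAc] : forall k, exists Ac, geo Ac.1 Ac.2 (f k) (a_ k).
  by move=> k; have [A [c ?]] := H k; exists (A, c).
have c0 k : 0 <= (Ac k).2 by have [_ /ltW] := HAc k.
have A0 k : 0 <= (Ac k).1 by have [] := HAc k.
exists (\sum_k (Ac k).1), (1 + \sum_k (Ac k).2).
split; first exact: sumr_ge0.
split; first by rewrite ltr_pwDl ?sumr_ge0.
move=> k; apply: geo_le (HAc k).
  by rewrite (bigD1 k) //= lerDl sumr_ge0.
by rewrite (bigD1 k) //= addrCA lerDl addr_ge0 ?sumr_ge0.
Qed.

(** Absolute convergence at the corner [(r, ..., r)] of a polydisc gives the Cauchy estimates with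
    ratio [1 / r]. The doubled ratio and the factor [2 ^+ n] are the cost of summing the tail over
    all multi-indices. *)
Lemma expansion_geo f a : ps_expansion f a -> exists A c, geo A c f a.
Proof.
move=> /near0_boxP [r r0 H]; pose w : 'cV[K]_n := const_mx r.
have bw : box r (w^~ 0) by move=> i; rewrite mxE ger0_norm // ltW.
have [[B0 HB0] _] := H w bw.
pose B := `|B0|.
have aB : coef_bound B r^-1 a.
  move=> Q; rewrite exprVn ler_pdivlMr ?exprn_gt0 //.
  have := HB0 (mdeg Q).+1; rewrite (bigD1 (BMultinom (ltnSn (mdeg Q)))) //= => le.
  have le1 : `|a Q * mmap1 (w^~ 0) Q| <= B0.
    by apply: le_trans le; rewrite lerDl sumr_ge0.
  have B00 : 0 <= B0 by apply: le_trans le1.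
  rewrite /B (ger0_norm B00); apply: le_trans le1.
  rewrite (_ : mmap1 _ Q = r ^+ mdeg Q).
    by rewrite normrM [`|r ^+ _|]ger0_norm ?exprn_ge0 // ltW.
  by rewrite -mmap1_cst /mmap1; apply: eq_bigr => i _; rewrite mxE.
have B0_ge0 : 0 <= B by rewrite normr_ge0.
have rV0 : 0 < r^-1 by rewrite invr_gt0.
exists (B * 2 ^+ n), (2 * r^-1); split.
- by rewrite mulr_ge0 ?exprn_ge0.
- by rewrite mulr_gt0.
- move=> Q; apply: le_trans (aB Q) _; rewrite -mulrA ler_wpM2l //.
  rewrite -[leLHS]mul1r; apply: ler_pM; rewrite ?exprn_ge0 ?(ltW rV0) //.
    by rewrite exprn_ege1 // ler1n.
  rewrite lerXn2r ?nnegrE ?mulr_ge0 ?(ltW rV0) //.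
  by rewrite ler_peMl ?(ltW rV0) // ler1n.
move=> rho z d rho0 rrho bz.
have rho_r : rho <= r.
  rewrite mulrAC ler_pdivrMr // mul1r in rrho; apply: le_trans rrho.
  by rewrite ler_peMl // ler1n.
have [_ cv] := H z (fun i => le_trans (bz i) rho_r).
apply/ler_addgt0Pr => e e0.
have /cvgrPdist_lt/(_ e e0) [N _ HN] := cv.
(* At degree [M] the truncation is within [e] of [f z], and beyond degree [d], so the tail estimate
   covers the rest. *)
pose M := maxn d N.
rewrite -(subrK (ps_trunc M a).@[z^~ 0] (f z)) -addrA addrC.
apply: le_trans (ler_normD _ _) (lerD _ _); last first.
  by apply/ltW/HN; rewrite /= leq_maxr.
apply: ps_trunc_tail => //; first exact: ltW.
exact: leq_maxl.
Qed.

(** The rate at [rho = 0] and [d = 1]: the error vanishes and the truncation is the constant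
    term. *)
Lemma geo_near0 A c f a : geo A c f a -> f 0 = a 0%MM.
Proof.
move=> [A0 c0 _ fT].
have Z : (fun i => (0 : 'cV[K]_n) i 0) =1 (fun=> 0) by move=> i; rewrite mxE.
have := fT 0 0 1%N (lexx 0); rewrite mulr0 ler01 expr1 mulr0 => /(_ isT).
have b0 : box 0 ((0 : 'cV[K]_n)^~ 0) by move=> i; rewrite mxE normr0.
move/(_ b0); rewrite normr_le0 subr_eq0 => /eqP ->.
rewrite meval_ps_trunc (bigD1 (bm0 : 'X_{1..n < 1})) //= mmap11 mulr1.
rewrite big1 ?addr0 // => P; rewrite -(inj_eq val_inj) /= -mdeg_eq0 => P0.
by have := bmdeg P; rewrite ltnS leqn0 (negPf P0).
Qed.

Hypothesis half_small : forall e : K, 0 < e -> exists N, (2^-1 : K) ^+ N < e.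

(** At radius [1 / (2 c)] the rate is [2^-1]; [half_small], the archimedean property of [K], turns
    it into convergence. *)
Lemma geo_expansion A c f a : geo A c f a -> ps_expansion f a.
Proof.
move=> [A0 c0 aAc fT]; apply/near0_boxP.
have r0 : 0 < 2^-1 / c by rewrite divr_gt0 ?invr_gt0.
have cr : c * (2^-1 / c) = 2^-1 by rewrite mulrC divfK ?gt_eqF.
have half1 : (2^-1 : K) <= 1 by rewrite invf_le1 ?ler1n.
exists (2^-1 / c) => // z bz; split.
  exists (A * 2 ^+ n) => d; apply: (@le_trans _ _
      (\sum_(Q : 'X_{1..n < d}) A * 2^-1 ^+ mdeg Q)).
    apply: ler_sum => Q _; rewrite -{1}cr exprMn mulrA normrM.
    by apply: ler_pM => //; exact: norm_mmap1_le.
  by rewrite -mulr_sumr ler_wpM2l // sum_half_le.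
apply/cvgrPdist_lt => e e0.
have e1 : 0 < e / (A + 1) by rewrite divr_gt0 // ltr_wpDl.
have [N HN] := half_small e1; exists N => // d /= Nd.
apply: le_lt_trans (fT _ z d (ltW r0) _ bz) _; rewrite cr //.
have lt1 : (2^-1 : K) ^+ d < e / (A + 1).
  by apply: le_lt_trans HN; rewrite ler_wiXn2l ?invr_ge0.
apply: le_lt_trans (_ : (A + 1) * 2^-1 ^+ d < e).
  by rewrite ler_wpM2r ?exprn_ge0 ?invr_ge0 // lerDl.
by rewrite mulrC -ltr_pdivlMr // ltr_wpDl.
Qed.

(** Extraction of the coefficients of a polynomial of degree at most [d] from its values at the
    nodes [k / d.+1], by inverting the Vandermonde matrix. It replaces Cauchy's formula or
    derivatives in the uniqueness of expansions. *)
Lemma interpolation d : exists (t : 'I_d.+1 -> K) (L : 'I_d.+1 -> 'I_d.+1 -> K),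
  (forall k, `|t k| <= 1) /\
  forall p q : 'I_d.+1, \sum_k L k q * t k ^+ p = (p == q)%:R.
Proof.
pose t (k : 'I_d.+1) : K := k%:R / d.+1%:R.
have tinj (i j : 'I_d.+1) : (i < j)%N -> t j - t i != 0.
  move=> ij; rewrite -mulrBl mulf_neq0 ?invr_eq0 ?pnatr_eq0 //.
  by rewrite subr_eq0 eqr_nat gtn_eqF.
pose V := Vandermonde d.+1 (\row_j t j).
have Vu : V \in unitmx.
  rewrite unitmxE det_Vandermonde unitfE; apply/prodf_neq0 => i _.
  by apply/prodf_neq0 => j ij; rewrite !mxE tinj.
exists t, (fun k q => invmx V k q); split=> [k|p q].
  rewrite ger0_norm ?divr_ge0 // ler_pdivrMr ?ltr0n // mul1r ler_nat.
  by rewrite ltnW.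
have /matrixP/(_ p q) := mulmxV Vu; rewrite !mxE => <-.
by apply: eq_bigr => k _; rewrite !mxE mulrC.
Qed.

(* Evaluating the truncation at degree [mdeg Q] on a grid of mesh [rho] and
   interpolating recovers [a Q * rho ^+ mdeg Q], which is thus O(rho ^ (mdeg Q + 1)). *)
Lemma ps_trunc_small_eq0 A C a : 0 <= A -> 0 < C ->
  (forall rho u d, 0 <= rho -> C * rho <= 1 -> box rho u ->
     `|(ps_trunc d a).@[u]| <= A * (C * rho) ^+ d) ->
  forall Q, a Q = 0.
Proof.
move=> A0 C0 H Q; set d := mdeg Q.
have [t [L [t1 tL]]] := interpolation d.
have Qd (P : 'X_{1..n}) i : (mdeg P <= d)%N -> (P i < d.+1)%N.
  by move=> Pd; rewrite ltnS (leq_trans _ Pd) // mdegE (bigD1 i) //= leq_addr.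
pose W (g : {ffun 'I_n -> 'I_d.+1}) := \prod_i L (g i) (inord (Q i)).
have extr (P : 'X_{1..n}) : (mdeg P <= d)%N ->
    \sum_g W g * mmap1 (fun i => t (g i)) P = (P == Q)%:R.
  move=> Pd; rewrite (eq_bigr (fun g : {ffun 'I_n -> 'I_d.+1} =>
     \prod_i (L (g i) (inord (Q i)) * t (g i) ^+ P i))); last first.
    by move=> g _; rewrite big_split.
  rewrite -(bigA_distr_bigA (fun i k => L k (inord (Q i)) * t k ^+ P i)) /=.
  have E i : \sum_k L k (inord (Q i)) * t k ^+ P i = (P i == Q i)%:R.
    rewrite -{1}(inordK (Qd P i Pd)) tL -(inj_eq val_inj) /= !inordK //.
      exact: Qd.
    exact: Qd.
  rewrite (eq_bigr _ (fun i _ => E i)); have [->|/eqP PQ] := eqVneq P Q.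
    by rewrite big1 // => i _; rewrite eqxx.
  have [i Pi] : exists i, P i != Q i.
    apply/existsP; apply: contra_notT PQ; rewrite negb_exists => /forallP PQ.
    by apply/mnmP => i; apply/eqP; have := PQ i; rewrite negbK.
  by rewrite (bigD1 i) //= (negPf Pi) mul0r.
pose S := \sum_g `|W g|.
have S0 : 0 <= S by apply: sumr_ge0.
apply/eqP; rewrite -normr_le0.
apply: (@small_le0 _ (S * A * C ^+ d.+1) C) => [||rho r0 Cr].
- by rewrite !mulr_ge0 ?exprn_ge0 // ltW.
- by [].
suff: `|a Q| * rho ^+ d <= S * A * C ^+ d.+1 * rho * rho ^+ d.
  by rewrite ler_pM2r ?exprn_gt0.
have -> : `|a Q| * rho ^+ d =
   `|\sum_g W g * (ps_trunc d.+1 a).@[fun i => rho * t (g i)]|.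
  have -> : \sum_g W g * (ps_trunc d.+1 a).@[fun i => rho * t (g i)] =
      \sum_(P : 'X_{1..n < d.+1}) a P * rho ^+ mdeg P *
         (\sum_g W g * mmap1 (fun i => t (g i)) P).
    under [RHS]eq_bigr do rewrite mulr_sumr.
    rewrite exchange_big /=; apply: eq_bigr => g _.
    rewrite meval_ps_trunc mulr_sumr; apply: eq_bigr => P _.
    rewrite mulrCA -mulrA; congr (_ * _); rewrite mulrCA; congr (_ * _).
    rewrite -mmap1_cst /mmap1 -big_split /=.
    by apply: eq_bigr => i _; rewrite exprMn.
  rewrite (bigD1 (BMultinom (ltnSn (mdeg Q)))) //= extr // eqxx mulr1.
  rewrite big1 ?addr0.
    by rewrite normrM [`|rho ^+ _|]ger0_norm ?exprn_ge0 ?ltW.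
  move=> P; rewrite -(inj_eq val_inj) /= => PQ.
  by rewrite extr ?(negPf PQ) ?mulr0 // -ltnS bmdeg.
apply: le_trans (ler_norm_sum _ _ _) _.
have -> : S * A * C ^+ d.+1 * rho * rho ^+ d = \sum_g `|W g| * (A * (C * rho) ^+ d.+1).
  by rewrite -mulr_suml -/S exprMn [rho ^+ d.+1]exprS !mulrA.
apply: ler_sum => g _; rewrite normrM ler_wpM2l //; apply: H => //.
  exact: ltW.
move=> i; rewrite normrM (ger0_norm (ltW r0)) ler_piMr //; exact: ltW.
Qed.

Lemma meval_ps_truncD d a b u :
  (ps_trunc d (fun Q => a Q - b Q)).@[u] =
  (ps_trunc d a).@[u] - (ps_trunc d b).@[u].
Proof.
rewrite !meval_ps_trunc -sumrB; apply: eq_bigr => Q _.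
by rewrite mulrBl.
Qed.

Lemma box_col rho (u : 'I_n -> K) : box rho u -> box rho ((\col_i u i)^~ 0).
Proof. by move=> bu i; rewrite mxE. Qed.

Lemma meval_col (p : {mpoly K[n]}) (u : 'I_n -> K) :
  p.@[(\col_i u i)^~ 0] = p.@[u].
Proof. by apply: meval_eq => i; rewrite mxE. Qed.

(** Uniqueness of the expansion: where [f = g], the two truncations at degree [d] both approximate
    the same value, so their difference is of order [rho ^+ d]. *)
Lemma geo_inj A c B e f g a b : geo A c f a -> geo B e g b ->
  (\forall z \near (0 : 'cV[K]_n), f z = g z) -> a =1 b.
Proof.
move=> [A0 c0 _ fa] [B0 e0 _ gb] /near0_boxP [r r0 fg] Q.
have rV0 : 0 < r^-1 by rewrite invr_gt0.
apply/eqP; rewrite -subr_eq0; apply/eqP.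
(* The constant [c + e + r^-1] puts every admissible [rho] within reach of both rates and inside the
   polydisc where [f = g]. *)
apply: (@ps_trunc_small_eq0 (A + B) (c + e + r^-1) (fun Q => a Q - b Q)).
- exact: addr_ge0.
- by rewrite addr_gt0 // addr_gt0.
move=> rho u d rho0 Crho bu; set C := c + e + r^-1.
have bound x : 0 <= x -> x <= C -> x * rho <= 1.
  by move=> x0 xC; apply: le_trans Crho; rewrite ler_wpM2r.
have cC : c <= C by rewrite /C -addrA lerDl addr_ge0 ?ltW.
have eC : e <= C by rewrite /C addrAC lerDr addr_ge0 ?ltW.
have rC : r^-1 <= C by rewrite /C lerDr addr_ge0 ?ltW.
rewrite meval_ps_truncD -!(meval_col _ u); set z := \col_i u i.
have bz := box_col bu; rewrite -/z in bz.
have rr : rho <= r.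
  by have := bound _ (ltW rV0) rC; rewrite mulrC ler_pdivrMr // mul1r.
have fgz : f z = g z by apply: fg => i; apply: le_trans (bz i) rr.
rewrite (_ : _ - _ = (f z - (ps_trunc d b).@[z^~ 0]) -
  (f z - (ps_trunc d a).@[z^~ 0])); last by rewrite opprB [RHS]addrC addrA subrK.
apply: le_trans (ler_normB _ _) _; rewrite mulrDl addrC; apply: lerD.
  apply: le_trans (fa _ _ d rho0 (bound _ (ltW c0) cC) bz) _.
  rewrite ler_wpM2l // lerXn2r ?nnegrE ?ler_wpM2r ?mulr_ge0 ?(ltW c0) //.
  by rewrite (le_trans (ltW c0)).
rewrite fgz; apply: le_trans (gb _ _ d rho0 (bound _ (ltW e0) eC) bz) _.
rewrite ler_wpM2l // lerXn2r ?nnegrE ?ler_wpM2r ?mulr_ge0 ?(ltW e0) //.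
by rewrite (le_trans (ltW e0)).
Qed.

End Germs.

(** * Stability of geometric expansions under composition *)

Section Composition.
Variables (K : numFieldType) (n : nat).
Implicit Types (Q P : 'X_{1..n}) (z : 'cV[K]_n).

Definition vgeo p (A c : K) (f : 'cV[K]_n -> 'cV[K]_p)
    (a : 'I_p -> 'X_{1..n} -> K) :=
  [/\ 0 <= A, 0 < c & forall k, geo A c (fun z => f z k 0) (a k)].

Lemma taylor_vgeo p (f : 'cV[K]_n -> 'cV[K]_p) a :
  taylor_series f a -> exists A c, vgeo A c f a.
Proof.
move=> fa; have [A [c [A0 [c0 H]]]] := geo_family (fun k => expansion_geo (fa k)).
by exists A, c.
Qed.

Lemma geo_bound1 A c f (a : 'X_{1..n} -> K) rho z : geo A c f a -> a 0%MM = 0 -> 0 <= rho ->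
  c * rho <= 1 -> box rho (z^~ 0) -> `|f z| <= A * (c * rho).
Proof.
move=> [A0 c0 _ fT] a0 r0 cr bz; have := fT _ _ 1%N r0 cr bz.
rewrite expr1 (_ : ps_trunc 1 a = 0) ?meval0 ?subr0 //.
rewrite /ps_trunc big1 // => P _; suff -> : (P : 'X_{1..n}) = 0%MM by rewrite a0 scale0r.
by apply/eqP; rewrite -mdeg_eq0 -leqn0 -ltnS bmdeg.
Qed.

Lemma vgeo_continuous0 p A c (f : 'cV[K]_n -> 'cV[K]_p) a :
  vgeo A c f a -> (forall k, a k 0%MM = 0) ->
  forall S : 'cV[K]_p -> Prop, (\forall z \near (0 : 'cV[K]_p), S z) ->
  \forall z \near (0 : 'cV[K]_n), S (f z).
Proof.
move=> [A0 c0 fa] a0 S /near0_boxP [r r0 Sr]; apply/near0_boxP.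
(* With radius [r / (A * c + r * c + 1)], both [c * rho <= 1] and [A * c * rho <= r] hold. *)
have D0 : 0 < A * c + r * c + 1 by rewrite addr_gt0 // ltr_wpDl ?mulr_ge0 ?mulr_gt0 // ltW.
exists (r / (A * c + r * c + 1)) => [|z bz]; first by rewrite divr_gt0.
have rho0 : 0 <= r / (A * c + r * c + 1) by rewrite divr_ge0 // ltW.
apply: Sr => i; apply: le_trans (geo_bound1 (fa i) (a0 i) rho0 _ bz) _.
  rewrite mulrA ler_pdivrMr // mul1r mulrC [_ + r * c]addrC -addrA lerDl.
  by rewrite addr_ge0 // mulr_ge0 // ltW.
rewrite !mulrA ler_pdivrMr // [A * c * r]mulrC ler_pM2l // -addrA lerDl.
by rewrite addr_ge0 // mulr_ge0 // ltW.
Qed.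

(** The factor [M] on the left avoids the exponent [mdeg Q - 1]. The estimate [lip] is
    multiplicative, with degrees adding up, so it reduces to a single variable. *)
Lemma mmap1_lip (M eta : K) (u v : 'I_n -> K) Q : 0 <= M -> 0 <= eta ->
  box M u -> box M v -> (forall i, `|u i - v i| <= eta) ->
  M * `|mmap1 u Q - mmap1 v Q| <= (mdeg Q)%:R * M ^+ mdeg Q * eta.
Proof.
move=> M0 e0 bu bv uv.
pose lip (x y : K) k := [/\ `|x| <= M ^+ k, `|y| <= M ^+ k &
  M * `|x - y| <= k%:R * M ^+ k * eta].
suff [] : lip (mmap1 u Q) (mmap1 v Q) (mdeg Q) by [].
have lip1 : lip 1 1 0%N by split; rewrite ?normr1 ?expr0 // subrr normr0 mulr0 !mul0r.
have lipM x y k x1 y1 l : lip x y k -> lip x1 y1 l -> lip (x * x1) (y * y1) (k + l)%N.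
  move=> [xk yk xy] [x1l y1l xy1]; split.
  - by rewrite normrM exprD ler_pM.
  - by rewrite normrM exprD ler_pM.
  rewrite exprD.
  have -> : x * x1 - y * y1 = (x - y) * x1 + y * (x1 - y1).
    by rewrite mulrBl mulrBr addrA subrK.
  apply: (@le_trans _ _ (M * (`|(x - y) * x1| + `|y * (x1 - y1)|))).
    by rewrite ler_wpM2l // ler_normD.
  rewrite mulrDr natrD [(_ + _) * (M ^+ k * _)]mulrDl [leRHS]mulrDl.
  apply: lerD.
    rewrite normrM [M * _]mulrA [leRHS](_ : _ = k%:R * M ^+ k * eta * M ^+ l).
      by apply: ler_pM => //; rewrite mulr_ge0.
    by ring.
  rewrite normrM mulrCA [leRHS](_ : _ = M ^+ k * (l%:R * M ^+ l * eta)).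
    by apply: ler_pM => //; rewrite mulr_ge0.
  by ring.
rewrite mdegE /mmap1; apply: (@big_ind3 _ _ _ lip) => // i _.
elim: (Q i) => [|k IH]; first by rewrite !expr0.
rewrite !exprS -add1n; apply: lipM => //; split; rewrite ?expr1 ?bu ?bv //.
by rewrite mul1r ler_wpM2l.
Qed.

(** The condition [4 * c * M <= 1] absorbs the factor [mdeg Q <= 2 ^ mdeg Q] of the Lipschitz bound
    and still leaves a geometric sum of ratio [2^-1], whence a constant independent of [d]. *)
Lemma ps_trunc_lip (A c M eta : K) (a : 'X_{1..n} -> K) d (u v : 'I_n -> K) :
  0 <= A -> 0 <= c -> coef_bound A c a -> 0 < M -> 0 <= eta ->
  4 * c * M <= 1 -> box M u -> box M v -> (forall i, `|u i - v i| <= eta) ->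
  `|(ps_trunc d a).@[u] - (ps_trunc d a).@[v]| <= A * 2 ^+ n / M * eta.
Proof.
move=> A0 c0 aAc M0 eta0 cM bu bv uv.
rewrite !meval_ps_trunc -sumrB; apply: le_trans (ler_norm_sum _ _ _) _.
have M0' := ltW M0.
apply: (@le_trans _ _ (\sum_(Q : 'X_{1..n < d}) A / M * eta * 2^-1 ^+ mdeg Q)).
  apply: ler_sum => Q _; rewrite -mulrBr normrM.
  have lip := mmap1_lip Q M0' eta0 bu bv uv.
  rewrite -ler_pdivlMl // in lip.
  apply: (@le_trans _ _ (A * c ^+ mdeg Q * (M^-1 * ((mdeg Q)%:R * M ^+ mdeg Q * eta)))).
    by apply: ler_pM.
  have -> : A * c ^+ mdeg Q * (M^-1 * ((mdeg Q)%:R * M ^+ mdeg Q * eta)) =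
     A / M * eta * ((mdeg Q)%:R * (c * M) ^+ mdeg Q).
    by rewrite exprMn; ring.
  rewrite ler_wpM2l ?mulr_ge0 ?invr_ge0 //.
  apply: (@le_trans _ _ (2 ^+ mdeg Q * (c * M) ^+ mdeg Q)).
    rewrite ler_wpM2r ?exprn_ge0 ?mulr_ge0 // -natrX ler_nat.
    exact/ltnW/ltn_expl.
  rewrite -exprMn lerXn2r ?nnegrE ?mulr_ge0 ?invr_ge0 //.
  rewrite -[leRHS]mul1r ler_pdivlMr // mulrC mulrA mulrA.
  by rewrite -natrM.
rewrite -mulr_sumr.
apply: le_trans (ler_wpM2l _ (sum_half_le K n d)) _.
  by rewrite ?mulr_ge0 ?invr_ge0.
by rewrite mulrAC [A / M * _]mulrAC.
Qed.

(** The error at degree [d] splits into three: [f] against its truncation at [g z], the truncation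
    of [f] at [g z] against the same at the truncation of [g], and the composed polynomial against
    its own truncation. These are bounded by the rate of [f], by [ps_trunc_lip] and by
    [maj_tail]. *)
Lemma geo_comp (f g : 'cV[K]_n -> 'cV[K]_n) (a b : 'I_n -> 'X_{1..n} -> K)
    (A c B e : K) k :
  geo A c (fun z => f z k 0) (a k) -> vgeo B e g b -> fmap0 b ->
  exists A1 c1, geo A1 c1 (fun z => f (g z) k 0) (fcomp a b k).
Proof.
move=> [A0 c0 aAc fT] [B0 e0 gb] b0.
have gB l : coef_bound B e (b l) by have [] := gb l.
pose N : K := 2 ^+ n; have N1 : 1 <= N by rewrite exprn_ege1 // ler1n.
have N0 : 0 <= N by apply: le_trans N1.
(* The summand [2 * e] makes the majorant series of [g] summable; [8 * c * B * N * e] keeps its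
   value below [M = 1 / (4 c)], where the majorant of [f] converges. *)
pose s' := 2 * e + 8 * c * B * N * e.
have ce0 : 0 <= c * B * N * e by rewrite !mulr_ge0 // ltW.
have s'0 : 0 < s'.
  by rewrite ltr_wpDr ?mulr_gt0 // -!mulrA mulr_ge0 // !mulrA.
pose s := s'^-1; have s0 : 0 < s by rewrite invr_gt0.
have cc0 := ltW c0; have ee0 := ltW e0; have ss0 := ltW s0; have s'0' := ltW s'0.
(* The majorant of [g] must have no constant term: its value then tends to 0 with the radius. *)
pose bh (Q : 'X_{1..n}) := if (1 <= mdeg Q)%N then B * e ^+ mdeg Q else 0.
have b_bh l Q : `|b l Q| <= bh Q.
  rewrite /bh; case: posnP => [/eqP|_]; last exact: gB.
  by rewrite mdeg_eq0 => /eqP ->; rewrite b0 normr0.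
pose ah (Q : 'X_{1..n}) := A * c ^+ mdeg Q.
have two_e rho : 0 <= rho -> s' * rho <= 1 -> 2 * e * rho <= 1.
  move=> r0; apply: le_trans; rewrite ler_wpM2r // lerDl.
  by rewrite -!mulrA mulr_ge0 // !mulrA.
have eight rho : 0 <= rho -> s' * rho <= 1 -> 8 * c * B * N * e * rho <= 1.
  by move=> r0; apply: le_trans; rewrite ler_wpM2r // lerDr mulr_ge0.
pose M := (4 * c)^-1; have M0 : 0 < M by rewrite invr_gt0 mulr_gt0.
have bhM rho d : 0 <= rho -> s' * rho <= 1 ->
    0 <= (ps_trunc d bh).@[fun=> rho] <= M.
  move=> r0 sr; rewrite meval_ps_trunc; apply/andP; split.
    apply: sumr_ge0 => Q _; rewrite mmap1_cst mulr_ge0 ?exprn_ge0 //.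
    by rewrite /bh; case: ifP => // _; rewrite mulr_ge0 // exprn_ge0.
  rewrite (eq_bigr (fun Q : 'X_{1..n < d} => if (1 <= mdeg Q)%N then
     B * (e * rho) ^+ mdeg Q else 0)); last first.
    move=> Q _; rewrite mmap1_cst /bh; case: ifP; rewrite ?mul0r // => _.
    by rewrite exprMn mulrA.
  rewrite -big_mkcond -mulr_sumr /=.
  have := sum_tail_le n 1 d (mulr_ge0 ee0 r0).
  rewrite mulrA => /(_ (two_e _ r0 sr)) le1.
  apply: le_trans (ler_wpM2l B0 le1) _.
  rewrite -[leRHS]mul1r ler_pdivlMr ?mulr_gt0 //.
  apply: le_trans (eight _ r0 sr); rewrite expr1 -/N.
  by rewrite [leLHS](_ : _ = 8 * c * B * N * e * rho) //; ring.
pose p d := ps_trunc d (a k) \mPo pst d b.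
pose q d := ps_trunc d ah \mPo [tuple ps_trunc d bh | l < n].
have pq d : maj (p d) (q d).
  apply: maj_comp => [//|l]; rewrite !tnth_mktuple.
  exact: maj_ps_trunc.
(* The bound is uniform in [d]; it yields both the Cauchy estimates of the composition and the third
   error term. *)
have qs d : (q d).@[fun=> s] <= A * N.
  rewrite comp_mpoly_meval meval_ps_trunc.
  apply: (@le_trans _ _ (\sum_(Q : 'X_{1..n < d}) A * 2^-1 ^+ mdeg Q)).
    apply: ler_sum => Q _; rewrite /ah -mulrA ler_wpM2l //.
    have ss : s' * s <= 1 by rewrite divff // gt_eqF.
    apply: (@le_trans _ _ (c ^+ mdeg Q * M ^+ mdeg Q)).
      rewrite ler_wpM2l ?exprn_ge0 // -(mmap1_cst M); apply: ler_prod => i _.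
      rewrite tnth_mktuple; have /andP [? ?] := bhM s d ss0 ss.
      by rewrite exprn_ge0 //= lerXn2r ?nnegrE ?(ltW M0).
    rewrite -exprMn lerXn2r ?nnegrE ?mulr_ge0 ?invr_ge0 ?mulr_ge0 //.
    rewrite /M invfM mulrCA divff ?gt_eqF // mulr1 lef_pV2 ?posrE //.
    by rewrite ler_nat.
  by rewrite -mulr_sumr ler_wpM2l // sum_half_le.
have A1 : A <= A * N by rewrite ler_peMr.
have e_s : e <= s'.
  rewrite /s' -[leLHS]mul1r; apply: (@le_trans _ _ (2 * e)).
    by rewrite ler_wpM2r // ler1n.
  by rewrite lerDl -!mulrA mulr_ge0 // !mulrA.
have cBe_s : 4 * c * B * e <= s'.
  apply: (@le_trans _ _ (8 * c * B * N * e)); last by rewrite lerDr mulr_ge0.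
  rewrite ler_wpM2r // -[leLHS]mulr1; apply: ler_pM => //.
    by rewrite !mulr_ge0.
  by rewrite !ler_wpM2r // ler_nat.
exists (A + 4 * (c * (A * N * B)) + A * N), s'.
have AN0 : 0 <= A * N by rewrite mulr_ge0.
have cANB : 0 <= 4 * (c * (A * N * B)) by rewrite !mulr_ge0.
split => //.
- by rewrite !addr_ge0.
- move=> Q; have := maj_coef Q (pq (mdeg Q).+1) ss0.
  rewrite /p -fcompE // /s exprVn ler_pdivrMr ?exprn_gt0 // => le1.
  apply: le_trans le1 _; rewrite ler_wpM2r ?exprn_ge0 //.
  by apply: le_trans (qs _) _; rewrite lerDr addr_ge0.
move=> rho z d r0 sr bz.
have er : e * rho <= 1 by apply: le_trans sr; rewrite ler_wpM2r.
have bgz : box (B * (e * rho)) ((g z)^~ 0).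
  by move=> i; apply: geo_bound1 (gb i) (b0 i) r0 er bz.
have cBer : 4 * c * B * e * rho <= 1 by apply: le_trans sr; rewrite ler_wpM2r.
have cg : c * (B * (e * rho)) <= s' * rho.
  rewrite !mulrA ler_wpM2r //; apply: le_trans cBe_s.
  by rewrite -!mulrA ler_peMl ?ler1n // !mulr_ge0.
have Ber0 : 0 <= B * (e * rho) by rewrite !mulr_ge0.
have term1 := fT _ _ d Ber0 (le_trans cg sr) bgz.
have rs : rho <= s.
  by rewrite -[leRHS]mul1r ler_pdivlMr // mulrC.
have term3 := maj_tail d (pq d) r0 s0 rs bz.
pose gd i := (ps_trunc d (b i)).@[z^~ 0].
have bgd : box M gd.
  move=> i; have /andP [_] := bhM rho d r0 sr; apply: le_trans.
  rewrite /gd !meval_ps_trunc; apply: le_trans (ler_norm_sum _ _ _) _.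
  apply: ler_sum => Q _; rewrite normrM mmap1_cst; apply: ler_pM => //.
  exact: norm_mmap1_le.
have bgM : box M ((g z)^~ 0).
  move=> i; apply: le_trans (bgz i) _.
  rewrite -[leRHS]mul1r ler_pdivlMr ?mulr_gt0 // mulrC !mulrA //.
have eta0 : 0 <= B * (e * rho) ^+ d by rewrite !mulr_ge0 ?exprn_ge0 ?mulr_ge0.
have cM : 4 * c * M <= 1 by rewrite divff // gt_eqF // mulr_gt0.
have term2 := ps_trunc_lip d A0 cc0 aAc M0 eta0 cM bgM bgd
   (fun i => let: And4 _ _ _ h := gb i in h _ _ d r0 er bz).
have -> : ps_trunc d (fcomp a b k) = ps_trunc d (fun P => (p d)@_P).
  by apply: eq_ps_trunc => Q Qd; rewrite /p -fcompE.
have pE : (p d).@[z^~ 0] = (ps_trunc d (a k)).@[gd].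
  rewrite comp_mpoly_meval; apply: meval_eq => i.
  by rewrite tnth_mktuple.
rewrite pE in term3.
rewrite (_ : _ - _ = (f (g z) k 0 - (ps_trunc d (a k)).@[(g z)^~ 0]) +
  ((ps_trunc d (a k)).@[(g z)^~ 0] - (ps_trunc d (a k)).@[gd]) +
  ((ps_trunc d (a k)).@[gd] - (ps_trunc d (fun P => (p d)@_P)).@[z^~ 0])); last first.
  by ring.
apply: le_trans (ler_normD _ _) _; rewrite mulrDl; apply: lerD; last first.
  apply: le_trans term3 _; rewrite mulrC /s invrK [rho * _]mulrC.
  by rewrite ler_wpM2r ?exprn_ge0 ?mulr_ge0.
apply: le_trans (ler_normD _ _) _; rewrite mulrDl; apply: lerD.
  apply: le_trans term1 _; rewrite ler_wpM2l // lerXn2r ?nnegrE ?mulr_ge0 //.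
apply: le_trans term2 _; rewrite invrK.
rewrite [leLHS](_ : _ = 4 * (c * (A * N * B)) * (e * rho) ^+ d); last first.
  by rewrite -/N; ring.
rewrite ler_wpM2l // lerXn2r ?nnegrE ?mulr_ge0 // ler_wpM2r //.
Qed.

End Composition.

(** * The majorant method with small divisors *)

Section Recursion.
Variables (K : numFieldType) (n : nat).
Implicit Types (Q P : 'X_{1..n}).
Variables (E e : 'X_{1..n} -> K).
Hypothesis E_gt0 : forall Q, 0 < E Q.
Hypothesis E0 : E 0%MM = 1.
Hypothesis e_ge1 : forall Q, 1 <= e Q.
Hypothesis E_mul : forall Q P, Q != 0%MM -> P != 0%MM ->
  e (Q + P)%MM * (E Q * E P) <= E (Q + P)%MM.

Let E_mul1 Q P : E Q * E P <= E (Q + P)%MM.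
Proof.
have [->|Q0] := eqVneq Q 0%MM; first by rewrite add0m E0 mul1r.
have [->|P0] := eqVneq P 0%MM; first by rewrite addm0 E0 mulr1.
apply: le_trans (E_mul Q0 P0).
by rewrite ler_peMl // mulr_ge0 // ltW.
Qed.

(* Splitting a product of two series without constant term costs one degree
   and gains the weight [e]. *)
Lemma wmajM_gain d (p q p1 q1 : {mpoly K[n]}) :
  wmaj E d p q -> wmaj E d p1 q1 ->
  p@_0%MM = 0 -> p1@_0%MM = 0 -> (forall Q, 0 <= q@_Q) -> (forall Q, 0 <= q1@_Q) ->
  forall Q, (mdeg Q <= d)%N -> e Q * `|(p * p1)@_Q| <= E Q * (q * q1)@_Q.
Proof.
move=> pq pq1 p0 p10 q0 q10 Q dQ; rewrite !mcoeffM mulr_sumr.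
have e0 : 0 <= e Q by apply: le_trans (e_ge1 Q).
apply: le_trans (ler_wpM2l e0 (ler_norm_sum _ _ _)) _.
rewrite mulr_sumr; apply: ler_sum => -[/= k1 k2] /eqP QE.
rewrite normrM; have EQ := ltW (E_gt0 Q).
have [->|k10] := eqVneq (k1 : 'X_{1..n}) 0%MM.
  by rewrite p0 normr0 mul0r mulr0 !mulr_ge0.
have [->|k20] := eqVneq (k2 : 'X_{1..n}) 0%MM.
  by rewrite p10 normr0 !mulr0 !mulr_ge0.
have dk : (mdeg k1 + mdeg k2 <= d)%N by rewrite -mdegD -QE.
have lt1 : (mdeg k1 < d)%N.
  by apply: leq_trans dk; rewrite -addn1 leq_add2l lt0n mdeg_eq0.
have lt2 : (mdeg k2 < d)%N.
  by apply: leq_trans dk; rewrite -add1n leq_add2r lt0n mdeg_eq0.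
apply: (@le_trans _ _ (e Q * (E k1 * q@_k1 * (E k2 * q1@_k2)))).
  by rewrite ler_wpM2l //; apply: ler_pM => //; [apply: pq|apply: pq1].
rewrite [E k1 * _ * _]mulrACA [leLHS]mulrA ler_wpM2r ?mulr_ge0 //.
by have := E_mul k10 k20; rewrite -QE.
Qed.

Variables (c r : K) (psi : 'I_n -> 'X_{1..n} -> K).
Hypothesis c_gt0 : 0 < c.
Hypothesis r_gt0 : 0 < r.
Hypothesis r_small : 16 * 2 ^+ n * c * r <= 1.
Hypothesis E1 : forall l, E U_(l)%MM = 1.
Hypothesis psi0 : fmap0 psi.
Hypothesis psi1 : forall s l, psi s U_(l)%MM = (s == l)%:R.

Let phi Q : K := if (2 <= mdeg Q)%N then c ^+ (mdeg Q).-1 else 0.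

Hypothesis psi_rec : forall s Q, (2 <= mdeg Q)%N ->
  exists h : 'I_n -> 'X_{1..n} -> K,
    (forall P, `|h s P| <= phi P) /\ `|psi s Q| <= e Q * `|fcomp h psi s Q|.

(** The unknown coefficients with their weight removed; the recursive inequality for [beta] contains
    no divisor any more. *)
Let beta s Q := `|psi s Q| / E Q.
Let b d := pst d beta.

Let beta_ge0 s Q : 0 <= beta s Q.
Proof. by rewrite divr_ge0 // ltW. Qed.

Let phi_ge0 Q : 0 <= phi Q.
Proof. by rewrite /phi; case: ifP => // _; rewrite exprn_ge0 // ltW. Qed.

Let b_ge0 d s Q : 0 <= (tnth (b d) s)@_Q.
Proof. by rewrite tnth_mktuple mcoeff_ps_trunc; case: ifP. Qed.

Let wmaj_b d s : wmaj E d (tnth (pst d.+1 psi) s) (tnth (b d) s).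
Proof.
move=> Q dQ; rewrite !tnth_mktuple !mcoeff_ps_trunc dQ (ltnW dQ : (mdeg Q < d.+1)%N).
by rewrite mulrC divfK ?gt_eqF.
Qed.

(** As [mdeg P >= 2], the monomial splits as a variable times a nonconstant monomial. Both factors
    have no constant term, so only their coefficients of degree below [mdeg Q] matter, and the
    splitting pays for [e Q] once. *)
Let monomial_gain d P Q : (2 <= mdeg P)%N -> (mdeg Q <= d)%N ->
  e Q * `|('X_[P] \mPo pst d.+1 psi)@_Q| <= E Q * ('X_[P] \mPo b d)@_Q.
Proof.
move=> P2 Qd.
have [i Pi] : exists i, P i != 0%N.
  apply/existsP; apply: contraTT P2; rewrite negb_exists => /forallP P0.
  rewrite (_ : P = 0%MM) ?mdeg0 //; apply/mnmP => i; rewrite mnm0E.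
  by apply/eqP; have := P0 i; rewrite negbK.
have [R PE] : exists R, P = (U_(i) + R)%MM.
  by exists (P - U_(i))%MM; rewrite addmC submK // lep1mP.
have R1 : R != 0%MM.
  by apply: contraTneq P2 => R0; rewrite PE R0 addm0 mdeg1.
rewrite PE mpolyXD !rmorphM /= !comp_mpolyXU -!tnth_nth.
have psi_0 j : (tnth (pst d.+1 psi) j)@_0%MM = 0 by apply: pst0.
apply: wmajM_gain => //.
- apply: wmaj_compX => //.
- rewrite comp_mpolyX; apply/eqd1P.
  have psi_1 j : eqd 1 (tnth (pst d.+1 psi) j) 0 by apply/eqd1P.
  move=> S S1; apply: (eqd0_monomial psi_1); apply: leq_trans S1 _.
  by rewrite lt0n mdeg_eq0.
- exact: ncoef_compX.
Qed.

(** The right-hand side only involves the coefficients of degree below [d], even when [mdeg Q = d];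
    the induction in [b_bound] rests on this. *)
Let beta_rec d s Q : (2 <= mdeg Q)%N -> (mdeg Q <= d)%N ->
  beta s Q <= (ps_trunc d.+1 phi \mPo b d)@_Q.
Proof.
move=> Q2 Qd; rewrite /beta ler_pdivrMr // mulrC.
have [h [hphi le1]] := psi_rec s Q2; apply: le_trans le1 _.
rewrite (@fcompE _ _ d.+1) // !comp_mpoly_sum !raddf_sum /= mulr_sumr.
have e0 : 0 <= e Q by apply: le_trans (e_ge1 Q).
apply: le_trans (ler_wpM2l e0 (ler_norm_sum _ _ _)) _.
rewrite mulr_sumr; apply: ler_sum => P _.
rewrite !comp_mpolyZ !mcoeffZ normrM.
apply: (@le_trans _ _ (e Q * (phi P * `|('X_[P] \mPo pst d.+1 psi)@_Q|))).
  by rewrite ler_wpM2l // ler_wpM2r.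
rewrite mulrCA [leRHS]mulrCA /phi; case: ifP => P2; last by rewrite !mul0r.
by rewrite ler_wpM2l ?exprn_ge0 ?(ltW c_gt0) // monomial_gain.
Qed.

(* The value at [r] of the truncated weighted series stays below [2 r]: the
   degree one part contributes [r], the rest is quadratic in [r]. *)
Let b_bound d s : (tnth (b d) s).@[fun=> r] <= 2 * r.
Proof.
elim: d s => [|d IH] s.
  rewrite tnth_mktuple meval_ps_trunc big1 ?mulr_ge0 ?ltW // => Q _.
  by have := bmdeg Q; rewrite ltn0.
have r0 := ltW r_gt0; have c0 := ltW c_gt0.
rewrite mulr_natl mulr2n tnth_mktuple meval_ps_trunc.
rewrite (bigID (fun Q : 'X_{1..n < d.+1} => (2 <= mdeg Q)%N)) /= addrC.
apply: lerD.
  apply: (@le_trans _ _ (\sum_(Q : 'X_{1..n < d.+1} | ~~ (1 < mdeg Q)%N)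
     if (Q : 'X_{1..n}) == U_(s)%MM then r else 0)).
    apply: ler_sum => Q; rewrite -leqNgt mmap1_cst leq_eqVlt => /orP[/mdeg1P [l /eqP QE]|].
      rewrite QE /beta psi1 E1 divr1 mdeg1 expr1 eq_mnm1 eq_sym.
      by case: eqP => _; rewrite ?normr1 ?normr0 ?mul1r ?mul0r.
    rewrite ltnS leqn0 mdeg_eq0 => /eqP ->.
    rewrite /beta psi0 normr0 mul0r mul0r.
    by case: ifP.
  rewrite -big_mkcondr /=; case: (ltnP 1 d.+1) => d1.
    have U1 : (mdeg U_(s)%MM < d.+1)%N by rewrite mdeg1.
    rewrite (big_pred1 (BMultinom U1)) // => Q /=.
    rewrite -[in RHS](inj_eq val_inj) /=.
    by case: eqP => [->|]; rewrite ?mdeg1 ?andbF.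
  rewrite big1 // => Q /andP[_ /eqP QE].
  by have := bmdeg Q; rewrite QE mdeg1 ltnNge d1.
pose F := ps_trunc d.+1 phi \mPo b d.
have F0 Q : 0 <= F@_Q.
  rewrite /F comp_mpoly_sum raddf_sum /=; apply: sumr_ge0 => P _.
  by rewrite comp_mpolyZ mcoeffZ mulr_ge0 // ncoef_compX.
apply: (@le_trans _ _ F.@[fun=> r]).
  apply: le_trans (ncoef_bsum_le d.+1 F0 r0).
  rewrite [leRHS](bigID (fun Q : 'X_{1..n < d.+1} => (2 <= mdeg Q)%N)) /=.
  rewrite -[leLHS]addr0; apply: lerD; last first.
    by apply: sumr_ge0 => Q _; rewrite mulr_ge0 ?exprn_ge0.
  apply: ler_sum => Q Q2; rewrite mmap1_cst ler_wpM2r ?exprn_ge0 //.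
  by apply: beta_rec => //; rewrite -ltnS bmdeg.
rewrite /F comp_mpoly_meval meval_ps_trunc.
apply: (@le_trans _ _ (\sum_(Q : 'X_{1..n < d.+1} | (2 <= mdeg Q)%N)
    c^-1 * (c * (2 * r)) ^+ mdeg Q)).
  rewrite [leRHS]big_mkcond; apply: ler_sum => Q _.
  rewrite /phi; case: ifP => Q2; last by rewrite mul0r.
  rewrite exprMn -{2}(prednK (ltnW Q2)) exprS !mulrA mulVf ?gt_eqF // mul1r.
  rewrite ler_wpM2l ?exprn_ge0 // -(mmap1_cst (2 * r)).
  apply: ler_prod => i _; rewrite exprn_ge0 ?ncoef_meval_ge0 //=.
  by rewrite lerXn2r ?nnegrE ?ncoef_meval_ge0 // mulr_ge0.
rewrite -mulr_sumr mulrC ler_pdivrMr //.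
have x0 : 0 <= c * (2 * r) by rewrite !mulr_ge0.
have N1 : 1 <= 2 ^+ n :> K by rewrite exprn_ege1 // ler1n.
have small : 16 * (c * r) <= 1.
  apply: le_trans r_small; rewrite -[16 * 2 ^+ n * c * r]mulrA.
  by rewrite ler_wpM2r ?mulr_ge0 // ler_peMr.
have x1 : 2 * (c * (2 * r)) <= 1.
  apply: le_trans small; rewrite (_ : 2 * (c * (2 * r)) = 4 * (c * r)); last by ring.
  by rewrite ler_wpM2r ?mulr_ge0 // ler_nat.
apply: le_trans (sum_tail_le n 2 d.+1 x0 x1) _.
(* The quadratic part is at most [(4 c r)^2 2^n / c], that is [16 2^n c r] times [r]: this is the
   origin of [r_small]. *)
rewrite (_ : _ * _ = (16 * 2 ^+ n * c * r) * (r * c)); last by ring.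
by rewrite ler_piMl // mulr_ge0.
Qed.

Lemma recursion_bound s Q : `|psi s Q| <= E Q * (2 * r * r^-1 ^+ mdeg Q).
Proof.
have := b_bound (mdeg Q).+1 s; rewrite tnth_mktuple => le1.
rewrite mulrC -ler_pdivrMr // exprVn ler_pdivlMr ?exprn_gt0 //.
apply: le_trans le1; apply: le_trans (ncoef_bsum_le (mdeg Q).+1 _ (ltW r_gt0)).
  rewrite (bigD1 (BMultinom (ltnSn (mdeg Q)))) //= mcoeff_ps_trunc ltnSn lerDl.
  apply: sumr_ge0 => P _; rewrite mulr_ge0 ?exprn_ge0 ?(ltW r_gt0) //.
  by rewrite mcoeff_ps_trunc; case: ifP.
by move=> P; rewrite mcoeff_ps_trunc; case: ifP.
Qed.

End Recursion.

(** * Counting small divisors *)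

Section Counting.
Variables (n : nat) (S : pred 'X_{1..n}).
Implicit Types (P Q R : 'X_{1..n}).
Local Open Scope nat_scope.

(* The maximal number of nodes labelled in [S] among the binary trees of
   height at most [d] with root [Q] in which every label is the sum of the
   labels of its two children. *)
Fixpoint cnt d Q : nat :=
  if d is d'.+1 then
    S Q + \max_(P : 'X_{1..n < mdeg Q} | ((P : 'X_{1..n}) != 0%MM) && (P <= Q)%MM)
            (cnt d' P + cnt d' (Q - P)%MM)
  else 0.

Lemma cnt_splitP d Q : cnt d.+1 Q = S Q \/
  exists P R, [/\ P != 0%MM, R != 0%MM, Q = (P + R)%MM &
                 cnt d.+1 Q = S Q + (cnt d P + cnt d R)].
Proof.
rewrite /=; pose C (P : 'X_{1..n < mdeg Q}) := ((P : 'X_{1..n}) != 0%MM) && (P <= Q)%MM.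
have [C0|] := posnP #|C|.
  by left; rewrite big_pred0 ?addn0 //; exact: card0_eq C0.
move/(eq_bigmax_cond (fun P : 'X_{1..n < mdeg Q} => cnt d P + cnt d (Q - P)%MM)).
move=> [P /andP [P0 PQ] ->]; right; exists P, (Q - P)%MM; split => //.
  rewrite -mdeg_eq0; have := bmdeg P; have := congr1 mdeg (submK PQ).
  by rewrite mdegD; lia.
by rewrite addmC submK.
Qed.

Lemma cnt_add d P R : P != 0%MM -> R != 0%MM ->
  S (P + R)%MM + (cnt d P + cnt d R) <= cnt d.+1 (P + R)%MM.
Proof.
move=> P0 R0 /=; rewrite leq_add2l.
have ltP : mdeg P < mdeg (P + R) by rewrite mdegD; rewrite -mdeg_eq0 in R0; lia.
rewrite (bigD1 (BMultinom ltP)) /= ?P0 ?lem_addr //.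
have -> : (P + R - P)%MM = R by rewrite addmC addmK.
exact: leq_maxl.
Qed.

Lemma cnt_mono d Q : cnt d Q <= cnt d.+1 Q.
Proof.
elim: d Q => [//|d IH] Q.
have [->|[P [R [P0 R0 -> ->]]]] := cnt_splitP d Q; first by rewrite leq_addr.
by apply: leq_trans (cnt_add _ P0 R0); rewrite leq_add2l leq_add.
Qed.

(** Height [mdeg Q] allows every splitting, since the labels are nonzero and degrees drop strictly
    along each branch. *)
Definition maxcnt Q := cnt (mdeg Q) Q.

(** After exponentiation this superadditivity, summed over scales and components, becomes the
    inequality required of the weights [E] and [e]. *)
Lemma maxcnt_add P R : P != 0%MM -> R != 0%MM ->
  S (P + R)%MM + (maxcnt P + maxcnt R) <= maxcnt (P + R)%MM.
Proof.
move=> P0 R0; rewrite /maxcnt.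
have cnt_le d e Q : d <= e -> cnt d Q <= cnt e Q.
  move=> /subnK <-; elim: (e - d) => [//|k IH].
  exact: leq_trans IH (cnt_mono _ _).
have dE : mdeg (P + R) = (mdeg (P + R)).-1.+1.
  by rewrite prednK // lt0n mdegD; rewrite -mdeg_eq0 in P0; lia.
rewrite dE; apply: leq_trans (cnt_add _ P0 R0); rewrite leq_add2l.
by apply: leq_add; apply: cnt_le; rewrite mdegD; rewrite -!mdeg_eq0 in P0 R0; lia.
Qed.

Variable m : nat.
Hypothesis S_large : forall Q, S Q -> m < mdeg Q.
Hypothesis S_gap : forall Q Q0, S Q -> S Q0 -> (Q <= Q0)%MM -> Q != Q0 ->
  m + mdeg Q <= mdeg Q0.

Lemma cnt_small d Q : mdeg Q <= m -> cnt d Q = 0.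
Proof.
elim: d Q => [//|d IH] Q Qm.
have SQ : S Q = false by apply: contraTF Qm => /S_large; rewrite -ltnNge.
have [->|[P [R [_ _ QE ->]]]] := cnt_splitP d Q; first by rewrite SQ.
by rewrite SQ !IH //; move: Qm; rewrite QE mdegD; lia.
Qed.

(* The second half is the induction hypothesis needed when only one child of a
   node [Q0] of [S] is large: the next node of [S] on that branch has degree
   smaller by at least [m]. *)
Lemma cnt_bound d Q :
  (m <= mdeg Q -> m * (cnt d Q).+1 <= 2 * mdeg Q) /\
  (forall Q0, S Q0 -> (Q <= Q0)%MM -> Q != Q0 -> m * (cnt d Q).+2 <= 2 * mdeg Q0).
Proof.
elim: d Q => [|d IH] Q.
  split=> [Qm|Q0 /S_large]; rewrite /= ?muln1; lia.
have le1 : m <= mdeg Q -> m * (cnt d.+1 Q).+1 <= 2 * mdeg Q.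
  move=> Qm; have [->|[P [R [P0 R0 QE ->]]]] := cnt_splitP d Q.
    by case SQ: (S Q); [have := S_large SQ|]; lia.
  have [P1 P2] := IH P; have [R1 R2] := IH R.
  have dQ : mdeg Q = mdeg P + mdeg R by rewrite QE mdegD.
  have small W : m <= mdeg W \/ cnt d W = 0.
    by have [|/ltnW/(cnt_small d)] := leqP m (mdeg W); [left|right].
  have PQ : (P <= Q)%MM by rewrite QE lem_addr.
  have RQ : (R <= Q)%MM by rewrite QE lem_addl.
  have nPQ : P != Q.
    by apply: contra R0 => /eqP/(congr1 mdeg) PE; rewrite -mdeg_eq0; lia.
  have nRQ : R != Q.
    by apply: contra P0 => /eqP/(congr1 mdeg) RE; rewrite -mdeg_eq0; lia.
  have [Pm|cP] := small P; have [Rm|cR] := small R.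
  (* When both children are large, their two bounds each have a spare unit: one pays for the node
     [Q], the other is kept for the conclusion. This explains the successor in the statement. *)
  - by have := P1 Pm; have := R1 Rm; case: (S Q); lia.
  - rewrite cR; case SQ: (S Q); first by have := P2 Q SQ PQ nPQ; lia.
    by have := P1 Pm; lia.
  - rewrite cP; case SQ: (S Q); first by have := R2 Q SQ RQ nRQ; lia.
    by have := R1 Rm; lia.
  - by rewrite cP cR; case SQ: (S Q); [have := S_large SQ|]; lia.
split=> // Q0 SQ0 QQ0 nQQ0; have mQ0 := S_large SQ0.
case SQ: (S Q).
  by have := S_gap SQ SQ0 QQ0 nQQ0; have := le1 (ltnW (S_large SQ)); lia.
have [->|[P [R [P0 R0 QE ->]]]] := cnt_splitP d Q; first by rewrite SQ; lia.
have [P1 P2] := IH P; have [R1 R2] := IH R; rewrite SQ.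
have dQ : mdeg Q = mdeg P + mdeg R by rewrite QE mdegD.
have dQQ0 : mdeg Q <= mdeg Q0.
  by rewrite -(submK QQ0) mdegD leq_addl.
have PQ0 : (P <= Q0)%MM by apply: lepm_trans QQ0; rewrite QE lem_addr.
have RQ0 : (R <= Q0)%MM by apply: lepm_trans QQ0; rewrite QE lem_addl.
have nPQ : P != Q0.
  by apply: contra R0 => /eqP/(congr1 mdeg) PE; rewrite -mdeg_eq0; lia.
have nRQ : R != Q0.
  by apply: contra P0 => /eqP/(congr1 mdeg) RE; rewrite -mdeg_eq0; lia.
have [Pm|/ltnW/(cnt_small d) cP] := leqP m (mdeg P);
    have [Rm|/ltnW/(cnt_small d) cR] := leqP m (mdeg R).
- by have := P1 Pm; have := R1 Rm; lia.
- by rewrite cR; have := P2 Q0 SQ0 PQ0 nPQ; lia.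
- by rewrite cP; have := R2 Q0 SQ0 RQ0 nRQ; lia.
- by rewrite cP cR; lia.
Qed.

Lemma maxcnt_bound Q : m * maxcnt Q <= 2 * mdeg Q.
Proof.
have [Qm|/ltnW/cnt_small cQ] := leqP m (mdeg Q).
  by apply: leq_trans (proj1 (cnt_bound (mdeg Q) Q) Qm); rewrite leq_mul2l leqnSn orbT.
by rewrite /maxcnt cQ muln0.
Qed.

End Counting.

(** * The weight built from the counts at all scales *)

Section BrjunoWeight.
Variables (R : realType) (n : nat).
Implicit Types (P Q : 'X_{1..n}) (s : 'I_n) (k : nat).
Variables (sd : 'X_{1..n} -> 'I_n -> R) (om : nat -> R) (theta : R).
Hypothesis theta_gt0 : 0 < theta.
Hypothesis theta_lt1 : theta < 1.
Hypothesis om_gt0 : forall k, (0 < k)%N -> 0 < om k.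
Hypothesis om_le : forall k Q s, (0 < k)%N -> (2 <= mdeg Q <= 2 ^ k)%N -> om k <= sd Q s.
Hypothesis sd_gap : forall k s Q Q0, (0 < k)%N -> (2 <= mdeg Q)%N ->
  sd Q s < theta * om k -> sd Q0 s < theta * om k ->
  (Q <= Q0)%MM -> Q != Q0 -> (2 ^ k + mdeg Q <= mdeg Q0)%N.
Variable C0 : R.
Hypothesis brjuno : forall K, \sum_(1 <= k < K) Num.max 0 (- ln (om k)) / 2 ^+ k <= C0.

(* [S k s] collects the indices whose divisor is small at scale [k]; a divisor
   that is small at scales [1 .. k] but not [k + 1] costs at most [w k]. *)
Let w k := Num.max 0 (- ln (theta * om k.+1)).
Let S k s Q := (2 <= mdeg Q)%N && (sd Q s < theta * om k).
Let g Q := w 0 + \sum_(1 <= k < mdeg Q) \sum_s w k * (S k s Q)%:R.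
Let L Q := w 0 * (mdeg Q).-1%:R +
  \sum_(1 <= k < mdeg Q) \sum_s w k * (maxcnt (S k s) Q)%:R.

Let w_ge0 k : 0 <= w k. Proof. by rewrite le_max lexx. Qed.

Lemma maxcnt_S k s Q : (0 < k)%N -> (2 ^ k * maxcnt (S k s) Q <= 2 * mdeg Q)%N.
Proof.
move=> k0; apply: maxcnt_bound => [P /andP[P2 sdP]|P Q0 /andP[P2 sdP] /andP[_ sdQ]].
  rewrite ltnNge; apply: contraTN sdP => P2k; rewrite -leNgt.
  apply: le_trans (om_le s k0 _); last by rewrite P2.
  by rewrite ler_piMl ?ltW ?om_gt0.
by apply: sd_gap sdQ => //; lra.
Qed.

(** Induction on a scale [K] at which the divisor is not small: if it is not small one scale earlier
    either, the induction hypothesis applies; otherwise the last summand alone pays for it. *)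
Lemma small_scales s Q K : (2 <= mdeg Q)%N -> (0 < K)%N -> theta * om K <= sd Q s ->
  - ln (sd Q s) <= w 0 + \sum_(1 <= k < K) w k * (S k s Q)%:R.
Proof.
move=> Q2; elim: K => [//|[_ _|K IH _]] oms.
  rewrite big_geq // addr0 le_max; apply/orP; right.
  by rewrite lerN2 ler_ln ?posrE ?(lt_le_trans _ oms) // mulr_gt0 ?om_gt0.
rewrite big_nat_recr //=.
have [le1|lt1] := leP (theta * om K.+1) (sd Q s).
  apply: le_trans (IH isT le1) _; rewrite addrA lerDl.
  by rewrite mulr_ge0.
apply: (@le_trans _ _ (w K.+1 * (S K.+1 s Q)%:R)); last first.
  rewrite addrA lerDr addr_ge0 // sumr_ge0 // => k _.
  by rewrite mulr_ge0.
rewrite /S Q2 lt1 /= mulr1 le_max; apply/orP; right.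
by rewrite lerN2 ler_ln ?posrE ?(lt_le_trans _ oms) // mulr_gt0 ?om_gt0.
Qed.

Let L_sum P N : (mdeg P <= N)%N ->
  L P <= w 0 * (mdeg P).-1%:R + \sum_(1 <= k < N) \sum_s w k * (maxcnt (S k s) P)%:R.
Proof.
move=> PN; rewrite lerD2l.
have [P0|P0] := posnP (mdeg P).
  rewrite P0 big_geq //; apply: sumr_ge0 => k _; apply: sumr_ge0 => s _.
  by rewrite mulr_ge0.
rewrite [leRHS](big_cat_nat P0 PN) /= lerDl.
by apply: sumr_ge0 => k _; apply: sumr_ge0 => s _; rewrite mulr_ge0.
Qed.

(** [g] bounds the cost of one divisor, and [L] the total cost over a splitting tree: [w 0] for each
    of at most [mdeg Q - 1] nodes that are sums, and [w k] for each node small at scale [k]. The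
    growth of [L] is linear because [maxcnt_S] leaves a multiple of the sum of the
    [w k / 2 ^+ k]. *)
Lemma brjuno_weight : exists (L g : 'X_{1..n} -> R) (C : R),
  [/\ L 0%MM = 0, forall l, L U_(l)%MM = 0, forall Q, 0 <= g Q &
      [/\ forall P Q, P != 0%MM -> Q != 0%MM -> g (P + Q)%MM + (L P + L Q) <= L (P + Q)%MM,
      0 <= C, forall Q, L Q <= C * (mdeg Q)%:R &
      forall Q s, (2 <= mdeg Q)%N -> - ln (sd Q s) <= g Q]].
Proof.
pose t := Num.max 0 (- ln theta).
exists L, g, (w 0 + n%:R * (2 * (t + 2 * C0))).
have C00 : 0 <= C0 by have := brjuno 0; rewrite big_geq.
have t0 : 0 <= t by rewrite le_max lexx.
(* The logarithm splits into the part of [theta], summed against [2 ^+ k] to at most [t], and that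
   of [om k.+1], whose index shift doubles the constant [C0]. *)
have wsum K : \sum_(1 <= k < K) w k / 2 ^+ k <= t + 2 * C0.
  apply: (@le_trans _ _ (\sum_(1 <= k < K)
     (t / 2 ^+ k + 2 * (Num.max 0 (- ln (om k.+1)) / 2 ^+ k.+1)))).
    apply: ler_sum_nat => k /andP[k1 _].
    rewrite (_ : 2 * (_ / _) = Num.max 0 (- ln (om k.+1)) / 2 ^+ k); last first.
      by rewrite exprS; field; rewrite expf_neq0.
    rewrite -mulrDl.
    rewrite ler_wpM2r ?invr_ge0 ?exprn_ge0 // /w lnM ?posrE ?om_gt0 // opprD.
    by rewrite ge_max addr_ge0 ?le_max ?lexx //= lerD // le_max lexx orbT.
  rewrite big_split /= -!mulr_sumr; apply: lerD.
    rewrite ler_piMr //.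
    have -> : \sum_(1 <= k < K) (2 ^+ k)^-1 = \sum_(1 <= k < K) (2^-1 : R) ^+ k.
      by apply: eq_bigr => k _; rewrite exprVn.
    have : \sum_(1 <= k < K.+1) (2^-1 : R) ^+ k = 1 - 2^-1 ^+ K.
      elim: K => [|K IH]; first by rewrite big_geq // expr0 subrr.
      by rewrite big_nat_recr //= IH exprS; lra.
    case: K => [|K]; first by rewrite !big_geq.
    rewrite [in X in X -> _]big_nat_recr //= => E.
    have h : 0 <= (2^-1 : R) ^+ K.+1 by rewrite exprn_ge0 // invr_ge0.
    by lra.
  rewrite ler_wpM2l //.
  pose F k := Num.max 0 (- ln (om k)) / 2 ^+ k.
  have F0 k : 0 <= F k by rewrite divr_ge0 ?exprn_ge0 // le_max lexx.
  case: K => [|K]; first by rewrite big_geq.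
  rewrite -(big_add1 _ _ 1 K.+2 xpredT F); apply: le_trans (brjuno K.+2).
  by rewrite [leRHS]big_ltn // lerDr F0.
split=> //.
- by rewrite /L mdeg0 big_geq // mulr0 addr0.
- by move=> l; rewrite /L mdeg1 big_geq // mulr0 addr0.
- move=> Q; rewrite addr_ge0 // sumr_ge0 // => k _; apply: sumr_ge0 => s _.
  by rewrite mulr_ge0.
split=> [P Q P0 Q0||Q|Q s Q2].
- have dP : (0 < mdeg P)%N by rewrite lt0n mdeg_eq0.
  have dQ : (0 < mdeg Q)%N by rewrite lt0n mdeg_eq0.
  have leP : (mdeg P <= mdeg (P + Q))%N by rewrite mdegD leq_addr.
  have leQ : (mdeg Q <= mdeg (P + Q))%N by rewrite mdegD leq_addl.
  apply: le_trans (lerD (lexx _) (lerD (L_sum leP) (L_sum leQ))) _.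
  have le1 : \sum_(1 <= k < mdeg (P + Q)) \sum_s w k * (S k s (P + Q)%MM)%:R +
     (\sum_(1 <= k < mdeg (P + Q)) \sum_s w k * (maxcnt (S k s) P)%:R +
      \sum_(1 <= k < mdeg (P + Q)) \sum_s w k * (maxcnt (S k s) Q)%:R) <=
     \sum_(1 <= k < mdeg (P + Q)) \sum_s w k * (maxcnt (S k s) (P + Q)%MM)%:R.
    rewrite -!big_split /=; apply: ler_sum => k _.
    rewrite -!big_split /=; apply: ler_sum => s _.
    by rewrite -!mulrDr ler_wpM2l // -!natrD ler_nat maxcnt_add.
  have dE : (mdeg (P + Q)).-1%:R = 1 + ((mdeg P).-1%:R + (mdeg Q).-1%:R) :> R.
    by rewrite -!natrD mdegD -(natrD _ 1%N); congr (GRing.natmul 1 _); lia.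
  rewrite /g /L dE; lra.
- by rewrite addr_ge0 // !mulr_ge0 // addr_ge0 // mulr_ge0.
- rewrite mulrDl; apply: lerD.
    by rewrite ler_wpM2l // ler_nat leq_pred.
  apply: (@le_trans _ _ (\sum_(1 <= k < mdeg Q) n%:R * (2 * (w k / 2 ^+ k) * (mdeg Q)%:R))).
    apply: ler_sum_nat => k /andP[k1 _].
    rewrite mulr_natl -[X in _ *+ X]card_ord -sumr_const; apply: ler_sum => s _.
    rewrite (_ : 2 * _ * _ = w k * ((2 * mdeg Q)%:R / 2 ^+ k)); last first.
      by rewrite natrM; ring.
    rewrite ler_wpM2l // ler_pdivlMr ?exprn_gt0 //.
    by rewrite -natrX -natrM ler_nat mulnC maxcnt_S.
  rewrite -mulr_sumr -mulr_suml -mulr_sumr -!mulrA ler_wpM2l //.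
  rewrite ler_wpM2l // ler_wpM2r //.
(* Since [mdeg Q <= 2 ^ mdeg Q], the divisor is no longer small at scale [mdeg Q], which is why the
   sums over scales stop there. *)
have K0 : (0 < mdeg Q)%N by apply: ltnW.
apply: le_trans (small_scales Q2 K0 _) _.
  apply: (@le_trans _ _ (om (mdeg Q))).
    by rewrite ler_piMl ?ltW ?om_gt0.
  by apply: om_le => //; rewrite Q2 /= ltnW // ltn_expl.
rewrite lerD2l; apply: ler_sum => k _.
rewrite [leRHS](bigD1 s) //= lerDl sumr_ge0 // => s' _.
by rewrite mulr_ge0.
Qed.

End BrjunoWeight.

(** * The small divisors of the family *)

Section Modulus.
Variable R : realType.
Implicit Types (x y : Cx R) (t : R).

Definition rc t : Cx R := (t%:C)%C.
(** The norm on [Cx R] has values in [Cx R]; [nrm] brings it to [R], where maxima, infima and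
    logarithms are available. *)
Definition nrm x : R := complex.Re `|x|.

Lemma rcE t : rc t = real_complex R t. Proof. by []. Qed.

Lemma nrmE x : `|x| = rc (nrm x).
Proof. by rewrite /rc /nrm RRe_real. Qed.

Lemma rc_le t u : (rc t <= rc u) = (t <= u). Proof. exact: lecR. Qed.
Lemma rc_lt t u : (rc t < rc u) = (t < u). Proof. exact: ltcR. Qed.
Lemma rcM t u : rc (t * u) = rc t * rc u. Proof. exact: rmorphM. Qed.
Lemma rcD t u : rc (t + u) = rc t + rc u. Proof. exact: rmorphD. Qed.
Lemma rc1 : rc 1 = 1. Proof. exact: rmorph1. Qed.
Lemma rc0 : rc 0 = 0. Proof. exact: rmorph0. Qed.
Lemma rcX t k : rc (t ^+ k) = rc t ^+ k. Proof. exact: rmorphXn. Qed.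
Lemma rcV t : rc t^-1 = (rc t)^-1. Proof. exact: fmorphV. Qed.

Lemma rc_inj t u : rc t = rc u -> t = u.
Proof. by move=> tu; apply/eqP; rewrite eq_le -!rc_le tu lexx. Qed.

Lemma nrmM x y : nrm (x * y) = nrm x * nrm y.
Proof. by apply: rc_inj; rewrite rcM -!nrmE normrM. Qed.

Lemma nrmD x y : nrm (x + y) <= nrm x + nrm y.
Proof. by rewrite -rc_le rcD -!nrmE ler_normD. Qed.

Lemma nrm_ge0 x : 0 <= nrm x.
Proof. by rewrite -rc_le rc0 -nrmE normr_ge0. Qed.

Lemma nrm_gt0 x : (0 < nrm x) = (x != 0).
Proof. by rewrite -rc_lt rc0 -nrmE normr_gt0. Qed.

Lemma nrmB x y : nrm (x - y) = nrm (y - x).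
Proof. by apply: rc_inj; rewrite -!nrmE distrC. Qed.

Lemma half_small (e : Cx R) : 0 < e -> exists N, (2^-1 : Cx R) ^+ N < e.
Proof.
move=> e0; have eE : e = rc (nrm e) by rewrite -nrmE gtr0_norm.
have ne0 : 0 < nrm e by rewrite nrm_gt0 gt_eqF.
exists (Num.bound (nrm e)^-1); rewrite [X in _ < X]eE (_ : 2^-1 = rc (2^-1)).
  rewrite -rcX rc_lt exprVn -[ltRHS]invrK ltf_pV2 ?posrE ?exprn_gt0 ?invr_gt0 //.
  apply: lt_le_trans (archi_boundP _) _; first by rewrite invr_ge0 ltW.
  by rewrite -natrX ler_nat; apply: ltnW; apply: ltn_expl.
by rewrite rcV rcE rmorph_nat.
Qed.

End Modulus.

Section SmallDivisors.
Variables (R : realType) (m n : nat) (mu : 'I_m -> 'I_m -> 'rV[Cx R]_n).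
Implicit Types (P Q : 'X_{1..n}) (i j : 'I_m) (s : 'I_n).
Hypothesis mu_neq0 : forall i j s, mu i j 0 s != 0.
Hypothesis nonres : forall Q s, (2 <= mdeg Q)%N ->
  exists i j, mmap1 (mu i j 0) Q != mu i j 0 s.

Local Notation sd := (small_divisor mu).
Local Notation om := (omega mu).

Lemma sd_ge i j Q s : nrm (mmap1 (mu i j 0) Q - mu i j 0 s) <= sd Q s.
Proof.
apply: le_trans (le_bigmax _ _ i).
exact: (le_bigmax _ (fun j => nrm (mmap1 (mu i j 0) Q - mu i j 0 s))).
Qed.

Lemma sd_ge0 Q s : 0 <= sd Q s.
Proof.
rewrite /small_divisor; elim/big_ind: _ => // [x y x0 y0|i _].
  by rewrite le_max x0.
elim/big_ind: _ => // [x y x0 y0|j _]; last exact: nrm_ge0.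
by rewrite le_max x0.
Qed.

Lemma sd_gt0 Q s : (2 <= mdeg Q)%N -> 0 < sd Q s.
Proof.
move=> Q2; have [i [j muQ]] := nonres s Q2.
by apply: lt_le_trans (sd_ge i j Q s); rewrite nrm_gt0 subr_eq0.
Qed.

Lemma sd_attained Q s : (2 <= mdeg Q)%N ->
  exists i j, sd Q s <= nrm (mmap1 (mu i j 0) Q - mu i j 0 s).
Proof.
move=> Q2; apply: contrapT => H; suff : sd Q s < sd Q s by rewrite ltxx.
apply: bigmax_lt => [|i _]; first exact: sd_gt0.
apply: bigmax_lt => [|j _]; first exact: sd_gt0.
by rewrite ltNge; apply/negP => le1; apply: H; exists i, j.
Qed.

Lemma om_le k Q s : (2 <= mdeg Q <= 2 ^ k)%N -> om k <= sd Q s.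
Proof.
move=> Qk; apply: ge_inf.
  by exists 0 => _ [_ [P [r [_ ->]]]]; apply: sd_ge0.
by split; [rewrite gt_eqF ?sd_gt0 //; case/andP: Qk|exists Q, s].
Qed.

Section Nonempty.
Variable s0 : 'I_n.

(** The index [s0] makes the set under the infimum nonempty, through a multi-index of degree 2; for
    [n = 0] that set is empty. *)
Lemma om_ge x k : (0 < k)%N -> (forall Q s, (2 <= mdeg Q <= 2 ^ k)%N -> x <= sd Q s) ->
  x <= om k.
Proof.
move=> k0 H; apply: lb_le_inf => [|_ [_ [Q [s [Qk ->]]]]]; last exact: H.
have d2 : mdeg (U_(s0) + U_(s0))%MM = 2 by rewrite mdegD !mdeg1.
exists (sd (U_(s0) + U_(s0))%MM s0); split.
  by rewrite gt_eqF // sd_gt0 // d2.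
exists (U_(s0) + U_(s0))%MM, s0; split => //.
by rewrite d2 /=; have := @leq_pexp2l 2 1 k isT k0; rewrite expn1.
Qed.

(** At a given scale only finitely many divisors compete, each positive by non-resonance. *)
Lemma om_gt0 k : (0 < k)%N -> 0 < om k.
Proof.
move=> k0.
pose F (p : 'X_{1..n < (2 ^ k).+1} * 'I_n) := sd p.1 p.2.
pose C (p : 'X_{1..n < (2 ^ k).+1} * 'I_n) := (2 <= mdeg p.1)%N.
apply: (@lt_le_trans _ _ (\big[Num.min/1]_(p | C p) F p)).
  by apply: lt_bigmin => // p Cp; apply: sd_gt0.
apply: om_ge => // Q s /andP[Q2 Qk].
exact: (bigmin_le_cond 1 F (j := (BMultinom (Qk : (mdeg Q < (2 ^ k).+1)%N), s))).
Qed.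

Lemma om_mono k : (0 < k)%N -> om k <= om 1.
Proof.
move=> k0; apply: om_ge => // Q s /andP[Q2 Qk]; apply: om_le.
by rewrite Q2 (leq_trans Qk) // leq_pexp2l.
Qed.

(** Let [P = Q0 - Q]. If [mu^Q] and [mu^(P + Q)] are both close to [mu_s], then [mu^P] is close to
    1: as [|mu^Q| >= |mu_s| / 2], one gets [|mu^P - 1| |mu_s| < 4 theta om k < om k] for all pairs
    [(i, j)]. The divisor of [P + U_(s)] is then below [om k], so its degree [mdeg P + 1] exceeds
    [2 ^ k]. *)
Lemma sd_gap theta k s Q Q0 : (0 < k)%N -> 0 < theta -> 4 * theta < 1 ->
  (forall i j, theta * om 1 <= nrm (mu i j 0 s) / 2) ->
  sd Q s < theta * om k -> sd Q0 s < theta * om k ->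
  (Q <= Q0)%MM -> Q != Q0 -> (2 ^ k + mdeg Q <= mdeg Q0)%N.
Proof.
move=> k0 th0 th4 th_mu sdQ sdQ0 QQ0 nQQ0.
have [P QE] : exists P, Q0 = (P + Q)%MM by exists (Q0 - Q)%MM; rewrite submK.
rewrite QE mdegD leq_add2r leqNgt; apply/negP => Pk.
have P0 : (0 < mdeg P)%N.
  by rewrite lt0n mdeg_eq0; apply: contra nQQ0 => /eqP P0; rewrite QE P0 add0m.
have dPs : mdeg (P + U_(s))%MM = (mdeg P).+1 by rewrite mdegD mdeg1 addn1.
have : om k <= sd (P + U_(s))%MM s by apply: om_le; rewrite dPs ltnS P0 Pk.
apply/negP; rewrite -ltNge.
have omk := om_gt0 k0; have thom := om_mono k0.
suff each i j : nrm (mmap1 (mu i j 0) (P + U_(s))%MM - mu i j 0 s) < om k.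
  by apply: bigmax_lt => // i _; apply: bigmax_lt => // j _; apply: each.
have muD (A B : 'X_{1..n}) : mmap1 (mu i j 0) (A + B)%MM = mmap1 (mu i j 0) A * mmap1 (mu i j 0) B.
  by rewrite /mmap1 -big_split; apply: eq_bigr => l _; rewrite mnmDE exprD.
rewrite muD mmap1U -[X in _ - X]mul1r -mulrBl nrmM.
set p := mmap1 _ P; set l := mu i j 0 s; pose a := mmap1 (mu i j 0) Q.
have hQ := le_lt_trans (sd_ge i j Q s) sdQ.
have hQ0 := le_lt_trans (sd_ge i j Q0 s) sdQ0.
rewrite -/l -/a in hQ; rewrite -/l QE muD -/p -/a in hQ0.
have l_th : theta * om k <= nrm l / 2.
  by apply: le_trans (th_mu i j); rewrite ler_wpM2l // ltW.
have la : nrm l <= nrm a + nrm (a - l).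
  by rewrite [nrm (a - l)]nrmB -{1}[l](subrKC a) nrmD.
have pa : nrm (p - 1) * nrm a <= nrm (p * a - l) + nrm (a - l).
  rewrite -nrmM mulrBl mul1r [nrm (a - l)]nrmB.
  by apply: le_trans (nrmD _ _); rewrite addrA subrK.
have pl : nrm (p - 1) * nrm l <= nrm (p - 1) * (2 * nrm a).
  by rewrite ler_wpM2l ?nrm_ge0 //; lra.
have : 4 * theta * om k < om k by rewrite -[ltRHS]mul1r ltr_pM2r.
lra.
Qed.

Lemma theta_exists : exists theta, [/\ 0 < theta, 4 * theta < 1 &
  forall i j s, theta * om 1 <= nrm (mu i j 0 s) / 2].
Proof.
pose F (p : 'I_m * 'I_m * 'I_n) := nrm (mu p.1.1 p.1.2 0 p.2).
pose kappa := \big[Num.min/1]_p F p.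
have k0 : 0 < kappa by apply: lt_bigmin => // p _; rewrite nrm_gt0.
have k1 : kappa <= 1 by apply: bigmin_le_id.
have o1 := om_gt0 (ltn0Sn 0).
have D0 : 0 < 2 * om 1 + 5 by lra.
(* The term 5 gives [4 * theta < 1] because [kappa <= 1]; the term [2 * om 1] gives
   [theta * om 1 <= kappa / 2]. *)
exists (kappa / (2 * om 1 + 5)); split; first by rewrite divr_gt0.
  by rewrite mulrA ltr_pdivrMr //; lra.
move=> i j s; have kF : kappa <= nrm (mu i j 0 s).
  exact: (bigmin_le_cond 1 F (j := (i, j, s))).
rewrite mulrAC ler_pdivrMr //.
have : 0 <= nrm (mu i j 0 s) * om 1 by rewrite mulr_ge0 ?nrm_ge0 // ltW.
have : kappa * om 1 <= nrm (mu i j 0 s) * om 1 by rewrite ler_wpM2r // ltW.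
have := nrm_ge0 (mu i j 0 s).
lra.
Qed.

(** The terms [ln (om k)] may have either sign. The positive ones are at most [W], because
    [om k <= om 1], so they contribute a bounded amount. If the sums of negative parts were
    unbounded, the series would tend to [-oo] and its opposite would not be below [+oo]. *)
Lemma diophantine_bounded : diophantine mu -> exists C0,
  forall K, \sum_(1 <= k < K) Num.max 0 (- ln (om k)) / 2 ^+ k <= C0.
Proof.
move=> dioph; apply: contrapT => unb.
pose W := Num.max 0 (ln (om 1)).
have W0 : 0 <= W by rewrite le_max lexx.
pose u k : R := Num.max 0 (- ln (om k)) / 2 ^+ k.
have u0 k : 0 <= u k by rewrite divr_ge0 ?exprn_ge0 // le_max lexx.
have partial K : \sum_(1 <= k < K) ln (om k) / 2 ^+ k <= W - \sum_(1 <= k < K) u k.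
  rewrite lerBrDr -big_split /=.
  apply: (@le_trans _ _ (\sum_(1 <= k < K) W * 2^-1 ^+ k)).
    apply: ler_sum_nat => k /andP[k1 _].
    rewrite -mulrDl exprVn ler_wpM2r ?invr_ge0 ?exprn_ge0 //.
    have [ge0|lt0] := leP 0 (- ln (om k)); last first.
      by rewrite addr0 le_max; apply/orP; right; rewrite ler_ln ?posrE ?om_gt0 ?om_mono.
    by rewrite subrr.
  rewrite -mulr_sumr ler_piMr //.
  have : \sum_(1 <= k < K.+1) (2^-1 : R) ^+ k = 1 - 2^-1 ^+ K.
    elim: K => [|K IH]; first by rewrite big_geq // expr0 subrr.
    by rewrite big_nat_recr //= IH exprS; lra.
  case: K => [|K]; first by rewrite !big_geq.
  rewrite [in X in X -> _]big_nat_recr //= => E.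
  have h : 0 <= (2^-1 : R) ^+ K.+1 by rewrite exprn_ge0 // invr_ge0.
  by lra.
move: dioph; rewrite /diophantine.
suff -> : (\sum_(1 <= k <oo) (ln (om k) / 2 ^+ k)%:E = -oo)%E by rewrite ltxx.
apply: cvg_lim => //; apply/cvgeNyPle => A.
have [K0 HK0] : exists K0, W - A < \sum_(1 <= k < K0) u k.
  apply: contrapT => H; apply: unb; exists (W - A) => K.
  by rewrite leNgt; apply/negP => lt1; apply: H; exists K.
exists K0 => // K /= K0K; rewrite sumEFin lee_fin.
apply: le_trans (partial K) _.
have : \sum_(1 <= k < K0) u k <= \sum_(1 <= k < K) u k.
  have [K00|K00] := leqP K0 1; first by rewrite [leLHS]big_geq // sumr_ge0.
  by rewrite [leRHS](big_cat_nat (ltnW K00) K0K) /= lerDl sumr_ge0.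
lra.
Qed.

End Nonempty.

Lemma small_divisor_weight : diophantine mu ->
  exists (E e : 'X_{1..n} -> Cx R) (G : Cx R),
  [/\ forall Q, 0 < E Q, E 0%MM = 1, forall l, E U_(l)%MM = 1, forall Q, 1 <= e Q &
  [/\ forall P Q, P != 0%MM -> Q != 0%MM -> e (P + Q)%MM * (E P * E Q) <= E (P + Q)%MM,
      0 < G, forall Q, E Q <= G ^+ mdeg Q &
      forall Q s, (2 <= mdeg Q)%N -> exists i j,
        mmap1 (mu i j 0) Q - mu i j 0 s != 0 /\
        `|mmap1 (mu i j 0) Q - mu i j 0 s|^-1 <= e Q]].
Proof.
move=> dioph; have [[s0 _]|noS] := pselect (exists s0 : 'I_n, True); last first.
  (* For [n = 0] there is no component, hence no divisor, and trivial weights do. *)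
  exists (fun=> 1), (fun=> 1), 1; split=> //; split=> // [Q|Q s].
  - by rewrite expr1n.
  - by case: noS; exists s.
have [theta [th0 th4 thmu]] := theta_exists s0.
have [C0 HC0] := diophantine_bounded s0 dioph.
have th1 : theta < 1 by lra.
have [L [g [C [L0 L1 g0 [Ladd C_ge0 LC gsd]]]]] := @brjuno_weight R n sd om theta
  th0 th1 (om_gt0 s0) (fun k Q s _ => @om_le k Q s)
  (fun k s Q Q0 k0 _ => @sd_gap s0 theta k s Q Q0 k0 th0 th4 (fun i j => thmu i j s)) C0 HC0.
(* Exponentials turn superadditivity into the product inequality and linear growth into geometric
   growth. *)
exists (fun Q => rc (expR (L Q))), (fun Q => rc (expR (g Q))), (rc (expR C)).
split=> [Q||l|Q|].
- by rewrite -rc0 rc_lt expR_gt0.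
- by rewrite L0 expR0 rc1.
- by rewrite L1 expR0 rc1.
- by rewrite -rc1 rc_le -expR0 ler_expR.
split=> [P Q P0 Q0||Q|Q s Q2].
- by rewrite -!rcM rc_le -!expRD ler_expR Ladd.
- by rewrite -rc0 rc_lt expR_gt0.
- by rewrite -rcX rc_le -expRM_natr ler_expR LC.
have [i [j sdij]] := sd_attained s Q2; have sdpos := sd_gt0 s Q2.
exists i, j; split; first by rewrite -nrm_gt0 (lt_le_trans sdpos).
rewrite nrmE -rcV rc_le; apply: (@le_trans _ _ (sd Q s)^-1).
  by rewrite lef_pV2 // posrE // (lt_le_trans sdpos).
rewrite -[leLHS]lnK ?posrE ?invr_gt0 // ler_expR lnV ?posrE //.
exact: gsd.
Qed.

End SmallDivisors.

(** * Constructing germs *)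

Section GermConstructions.
Variables (K : numFieldType) (n : nat).
Implicit Types (f g : 'cV[K]_n -> K) (a b : 'X_{1..n} -> K).

Lemma geo_eq_fun A c f a g b : geo A c f a -> a =1 b ->
  (forall z, f z = g z) -> geo A c g b.
Proof.
move=> [A0 c0 aAc fT] ab fg; split=> // [Q|rho z d r0 cr bz]; first by rewrite -ab.
rewrite -fg -(eq_ps_trunc (a := a)); first exact: fT.
by move=> Q _; apply: ab.
Qed.

Lemma geoD A c f a g b : geo A c f a -> geo A c g b ->
  geo (A + A) c (fun z => f z + g z) (fun Q => a Q + b Q).
Proof.
move=> [A0 c0 aAc fT] [_ _ bAc gT]; split=> // [|Q|rho z d r0 cr bz].
- exact: addr_ge0.
- by rewrite mulrDl; apply: le_trans (ler_normD _ _) (lerD _ _).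
have -> : ps_trunc d (fun Q => a Q + b Q) = ps_trunc d a + ps_trunc d b.
  by rewrite /ps_trunc -big_split; apply: eq_bigr => Q _; rewrite scalerDl.
rewrite mevalD mulrDl opprD addrACA.
by apply: le_trans (ler_normD _ _) (lerD _ _); [apply: fT|apply: gT].
Qed.

Lemma vgeo_linear (A : 'M[K]_n) :
  vgeo (\sum_k \sum_l `|A k l|) 1 (fun z => A *m z) (flin A).
Proof.
set S := \sum_k _; have S0 : 0 <= S by apply: sumr_ge0 => k _; apply: sumr_ge0.
have S_k k : \sum_l `|A k l| <= S.
  by rewrite /S [leRHS](bigD1 k) //= lerDl; apply: sumr_ge0 => i _; apply: sumr_ge0.
split=> // k; split=> // [Q|rho z d r0 cr bz].
  rewrite expr1n mulr1; have [Q1|Q1] := eqVneq (mdeg Q) 1%N; last first.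
    by rewrite flin_ge2 // normr0.
  have /mdeg1P [l /eqP ->] : mdeg Q == 1%N by apply/eqP.
  rewrite flin1; apply: le_trans (S_k k); rewrite (bigD1 l) //= lerDl.
  exact: sumr_ge0.
have [d1|d1] := ltnP 1 d.
  rewrite ps_trunc_flin // (raddf_sum (meval (z^~ 0))) mxE -sumrB big1 ?normr0.
    by rewrite mulr_ge0 ?exprn_ge0 ?mulr_ge0.
  by move=> l _ /=; rewrite mevalZ mevalXU subrr.
have -> : ps_trunc d (flin A k) = 0.
  rewrite /ps_trunc big1 // => Q _; rewrite flin_ge2 ?scale0r //.
  by rewrite neq_ltn (leq_trans (bmdeg Q)).
rewrite meval0 subr0 mul1r; rewrite mul1r in cr.
apply: (@le_trans _ _ (S * rho)).
  rewrite mxE; apply: le_trans (ler_norm_sum _ _ _) _.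
  apply: (@le_trans _ _ ((\sum_l `|A k l|) * rho)).
    by rewrite mulr_suml; apply: ler_sum => l _; rewrite normrM ler_wpM2l // bz.
  by rewrite ler_wpM2r.
rewrite ler_wpM2l //; case: d d1 => [_|[|//] _]; first by rewrite expr0.
by rewrite expr1.
Qed.

Lemma vgeo_comp (f g : 'cV[K]_n -> 'cV[K]_n) A c B e
    (a b : 'I_n -> 'X_{1..n} -> K) :
  vgeo A c f a -> vgeo B e g b -> fmap0 b ->
  exists A1 c1, vgeo A1 c1 (f \o g) (fcomp a b).
Proof.
move=> [_ _ fa] gb b0.
have [A1 [c1 [A10 [c10 H]]]] := geo_family (fun k => geo_comp (fa k) gb b0).
by exists A1, c1.
Qed.

Hypothesis half_small : forall e : K, 0 < e -> exists N, (2^-1 : K) ^+ N < e.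

(** Converse of [geo_inj]: at radius [1 / (2 (c + e))] both rates are at most [2^-1], so the two
    functions are arbitrarily close to the same truncations. *)
Lemma geo_germ_eq A c B e f g a b : geo A c f a -> geo B e g b -> a =1 b ->
  \forall z \near (0 : 'cV[K]_n), f z = g z.
Proof.
move=> [A0 c0 _ fT] [B0 e0 _ gT] ab; apply/near0_boxP.
have D0 : 0 < 2 * (c + e) by rewrite mulr_gt0 // addr_gt0.
exists (2 * (c + e))^-1 => [|z bz]; first by rewrite invr_gt0.
have r0 : 0 <= (2 * (c + e))^-1 by rewrite invr_ge0 ltW.
have half x : 0 < x -> x <= c + e -> 0 <= x * (2 * (c + e))^-1 <= 2^-1.
  move=> x0 xce; rewrite mulr_ge0 ?(ltW x0) //= ler_pdivrMr //.
  by rewrite mulKf.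
have /andP[c1 c2] : 0 <= c * (2 * (c + e))^-1 <= 2^-1.
  by apply: half => //; rewrite lerDl ltW.
have /andP[e1 e2] : 0 <= e * (2 * (c + e))^-1 <= 2^-1.
  by apply: half => //; rewrite lerDr ltW.
have h1 : (2^-1 : K) <= 1 by rewrite invf_le1 ?ler1n.
have AB0 : 0 < A + B + 1 by rewrite ltr_wpDl // addr_ge0.
apply/eqP; rewrite -subr_eq0 -normr_le0; apply/ler_addgt0Pr => t t0.
have [N HN] := half_small (divr_gt0 t0 AB0).
rewrite add0r; apply/ltW; apply: (@le_lt_trans _ _ ((A + B + 1) * 2^-1 ^+ N)).
  rewrite (_ : f z - g z = (f z - (ps_trunc N a).@[z^~ 0]) -
     (g z - (ps_trunc N a).@[z^~ 0])); last by ring.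
  apply: le_trans (ler_normB _ _) _; rewrite mulrDl mul1r.
  apply: (@le_trans _ _ ((A + B) * 2^-1 ^+ N)); last first.
    by rewrite lerDl exprn_ge0 // invr_ge0.
  rewrite mulrDl; apply: lerD.
    apply: le_trans (fT _ z N r0 (le_trans c2 h1) bz) _.
    by rewrite ler_wpM2l // lerXn2r ?nnegrE ?invr_ge0.
  rewrite (eq_ps_trunc (b := b)) => [|Q _]; last exact: ab.
  apply: le_trans (gT _ z N r0 (le_trans e2 h1) bz) _.
  by rewrite ler_wpM2l // lerXn2r ?nnegrE ?invr_ge0.
by rewrite mulrC -ltr_pdivlMr.
Qed.

Lemma vgeo_germ_eq A c B e (f g : 'cV[K]_n -> 'cV[K]_n)
    (a b : 'I_n -> 'X_{1..n} -> K) :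
  vgeo A c f a -> vgeo B e g b -> a =2 b -> germ_eq f g.
Proof.
move=> [_ _ fa] [_ _ gb] ab.
have H k : \forall z \near (0 : 'cV[K]_n), f z k 0 = g z k 0.
  exact: geo_germ_eq (fa k) (gb k) (ab k).
have H1 : \forall z \near (0 : 'cV[K]_n), forall k, f z k 0 = g z k 0.
  exact: (@filter_forall _ _ (fun k z => f z k 0 = g z k 0) _ _ H).
apply: filterS H1 => z fg; apply/matrixP => i j; rewrite (ord1 j); exact: fg.
Qed.

Lemma vgeo_analytic p A c (f : 'cV[K]_n -> 'cV[K]_p)
    (a : 'I_p -> 'X_{1..n} -> K) :
  vgeo A c f a -> analytic_germ f.
Proof.
by move=> [_ _ fa]; exists a => k; apply: geo_expansion (fa k).
Qed.

End GermConstructions.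

(** * Linear coefficients and the differential *)

Section DiffCoef.
Variables (K : numFieldType) (n : nat).

(** At the point [t] of the [l]-th axis the expansion gives [a t + O(t^2)], while the vanishing
    differential gives [o(t)]; hence [a = 0]. *)
Lemma diff0_coef (f : 'cV[K]_n -> 'cV[K]_n) A c
    (a : 'I_n -> 'X_{1..n} -> K) k l :
  vgeo A c f a -> is_diff (0 : 'cV[K]_n) f (fun=> 0) -> f 0 = 0 ->
  a k U_(l)%MM = 0.
Proof.
move=> [A0 c0 fa] [df d0] f0.
have a0 : a k 0%MM = 0 by rewrite -(geo_near0 (fa k)) f0 mxE.
apply/eqP; rewrite -normr_le0; apply/ler_addgt0Pr => eps eps0.
have [r r0 small] : exists2 r, 0 < r &
    forall z : 'cV[K]_n, box r (z^~ 0) -> `|f z| <= eps * `|z|.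
  apply/near0_boxP; have /eqaddoP/(_ eps eps0) := diff_locally df.
  apply: filterS => z; rewrite d0 /= !fctE /= f0 addr0.
  by rewrite addr0 subr0.
rewrite add0r -subr_le0; apply: (@small_le0 _ _ (A * c ^+ 2) (c + r^-1)).
- by rewrite mulr_ge0 ?exprn_ge0 // ltW.
- by rewrite addr_gt0 ?invr_gt0.
move=> t t0 ct; have t0' := ltW t0.
pose z : 'cV[K]_n := \col_i (t * (i == l)%:R).
have bz : box t (z^~ 0).
  move=> i; rewrite mxE normrM ger0_norm //.
  by case: eqP; rewrite ?normr1 ?normr0 ?mulr1 ?mulr0.
have ct1 : c * t <= 1.
  by apply: le_trans ct; rewrite ler_wpM2r // lerDl invr_ge0 ltW.
have tr : t <= r.
  have : r^-1 * t <= 1 by apply: le_trans ct; rewrite ler_wpM2r // lerDr ltW.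
  by rewrite mulrC ler_pdivrMr // mul1r.
have [_ _ _ fT] := fa k; have := fT t z 2%N t0' ct1 bz.
have a_0 : fmap0 a by move=> i; rewrite -(geo_near0 (fa i)) f0 mxE.
rewrite (eq_ps_trunc (b := flin (\matrix_(i, j) a i U_(j)%MM) k)); last first.
  by move=> Q; apply: flin_deg1.
rewrite ps_trunc_flin // (raddf_sum (meval (z^~ 0))) (bigD1 l) //=.
rewrite big1 => [|j jl]; last first.
  by rewrite mevalZ mevalXU [z _ _]mxE (negPf jl) mulr0 mulr0.
rewrite addr0 mevalZ mevalXU !mxE eqxx mulr1 => le1.
have le2 : `|f z k 0| <= eps * t.
  apply: le_trans (box_norm _ k) _; apply: le_trans (small z _) _.
    by move=> i; apply: le_trans (bz i) tr.
  by rewrite ler_wpM2l ?(ltW eps0) // norm_le_box.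
have : `|a k U_(l)%MM| * t <= (eps + A * c ^+ 2 * t) * t.
  rewrite -[X in _ * X <= _](ger0_norm t0') -normrM.
  rewrite -[a k _ * t](subKr (f z k 0)); apply: le_trans (ler_normB _ _) _.
  rewrite mulrDl; apply: lerD => //; apply: le_trans le1 _.
  by rewrite (_ : A * (c * t) ^+ 2 = A * c ^+ 2 * t * t) //; ring.
by rewrite ler_pM2r // -lerBlDl.
Qed.

End DiffCoef.

(** * Complex conjugation of germs *)

Section Conjugation.
Variables (R : realType) (n : nat).
Notation C := (Cx R).
Implicit Types (z : 'cV[C]_n) (Q : 'X_{1..n}).

Lemma conjvK : involutive (@conjv R n).
Proof. by move=> z; apply/matrixP => i j; rewrite !mxE conjCK. Qed.

Lemma conjv_mul (A : 'M[C]_n) z : conjv (A *m z) = map_mx Num.conj A *m conjv z.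
Proof. exact: map_mxM. Qed.

Lemma box_conjv rho z : box rho (z^~ 0) -> box rho ((conjv z)^~ 0).
Proof. by move=> bz i; rewrite mxE norm_conjC. Qed.

Lemma near0_conjv (S : 'cV[C]_n -> Prop) :
  (\forall z \near (0 : 'cV[C]_n), S z) ->
  \forall z \near (0 : 'cV[C]_n), S (conjv z).
Proof.
move=> /near0_boxP [r r0 Sr]; apply/near0_boxP; exists r => // z bz.
by apply: Sr; apply: box_conjv.
Qed.

Lemma conj_mmap1 (u : 'I_n -> C) Q : (mmap1 u Q)^* = mmap1 (fun i => (u i)^*) Q.
Proof. by rewrite /mmap1 rmorph_prod; apply: eq_bigr => i _; rewrite rmorphXn. Qed.

(** Conjugating at both ends preserves holomorphy; compositions with antiholomorphic involutions
    thereby become compositions of power series. *)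
Lemma vgeo_conj A c (f : 'cV[C]_n -> 'cV[C]_n) a : vgeo A c f a ->
  vgeo A c (fun z => conjv (f (conjv z))) (fun k Q => (a k Q)^*).
Proof.
move=> [A0 c0 fa]; split=> [||k]; [exact: A0|exact: c0|].
have [_ _ aAc fT] := fa k.
split=> [||Q|rho z d r0 cr bz]; [exact: A0|exact: c0| |].
  by rewrite norm_conjC; exact: aAc.
have := fT _ _ d r0 cr (box_conjv bz).
rewrite -norm_conjC rmorphB /= mxE; congr (`| _ - _ | <= _).
rewrite !meval_ps_trunc rmorph_sum; apply: eq_bigr => Q _.
rewrite rmorphM /= conj_mmap1; congr (_ * _); apply: eq_bigr => i _.
by rewrite mxE conjCK.
Qed.

End Conjugation.

(** * From coefficient bounds to holomorphic germs *)

Section Completeness.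
Variable R : realType.
Notation C := (Cx R).

Lemma nrm_sqrt (x : C) :
  nrm x = Num.sqrt (complex.Re x ^+ 2 + complex.Im x ^+ 2).
Proof. by rewrite /nrm normc_def. Qed.

Lemma Re_le_nrm (x : C) : `|complex.Re x| <= nrm x.
Proof. by rewrite nrm_sqrt -sqrtr_sqr ler_wsqrtr // lerDl sqr_ge0. Qed.

Lemma Im_le_nrm (x : C) : `|complex.Im x| <= nrm x.
Proof. by rewrite nrm_sqrt -sqrtr_sqr ler_wsqrtr // lerDr sqr_ge0. Qed.

Lemma nrm_le_ReIm (x : C) : nrm x <= `|complex.Re x| + `|complex.Im x|.
Proof.
have s0 : 0 <= `|complex.Re x| + `|complex.Im x| by rewrite addr_ge0.
rewrite nrm_sqrt -[leRHS](ger0_norm s0) -[leRHS]sqrtr_sqr ler_wsqrtr //.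
rewrite sqrrD !real_normK ?num_real //.
by rewrite addrAC lerDl mulrn_wge0 // mulr_ge0.
Qed.

Lemma real_geometric_cvg (u : nat -> R) (A : R) :
  (forall d e, (d <= e)%N -> `|u e - u d| <= A * 2^-1 ^+ d) ->
  cvgn u.
Proof.
move=> Hu; apply/cauchy_cvgP/cauchy_exP => eps eps0.
have A0 : 0 <= A by have := Hu 0%N 0%N (leqnn _); rewrite expr0 mulr1; apply: le_trans.
have [N HN] : exists N, A * 2^-1 ^+ N < eps.
  have AB0 : 0 < A + 1 by rewrite ltr_wpDl.
  exists (Num.bound ((A + 1) / eps)).
  apply: (@le_lt_trans _ _ ((A + 1) * 2^-1 ^+ Num.bound ((A + 1) / eps))).
    by rewrite ler_wpM2r ?exprn_ge0 ?invr_ge0 // lerDl.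
  rewrite exprVn ltr_pdivrMr ?exprn_gt0 // mulrC -ltr_pdivrMr //.
  apply: lt_le_trans (archi_boundP _) _; first by rewrite divr_ge0 // ltW.
  by rewrite -natrX ler_nat; apply: ltnW; apply: ltn_expl.
exists (u N); exists N => // e /= Ne.
by rewrite /ball /= distrC; apply: le_lt_trans HN; apply: Hu.
Qed.

Lemma complex_geometric_cvg (u : nat -> C) (A : R) :
  (forall d e, (d <= e)%N -> nrm (u e - u d) <= A * 2^-1 ^+ d) ->
  exists l : C, forall eps : R, 0 < eps -> exists N, forall d, (N <= d)%N ->
    nrm (l - u d) < eps.
Proof.
move=> Hu.
have cvRe : cvgn (fun d => complex.Re (u d)).
  apply: (@real_geometric_cvg _ A) => d e de; apply: le_trans (Hu _ _ de).
  by rewrite -raddfB Re_le_nrm.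
have cvIm : cvgn (fun d => complex.Im (u d)).
  apply: (@real_geometric_cvg _ A) => d e de; apply: le_trans (Hu _ _ de).
  by rewrite -raddfB Im_le_nrm.
set x := limn (fun d => complex.Re (u d)) in cvRe.
set y := limn (fun d => complex.Im (u d)) in cvIm.
exists ((x +i* y)%C : C) => eps eps0.
have e2 : 0 < eps / 2 by rewrite divr_gt0.
have /cvgrPdist_lt/(_ _ e2) [N1 _ HN1] : complex.Re (u d) @[d --> \oo] --> x by [].
have /cvgrPdist_lt/(_ _ e2) [N2 _ HN2] : complex.Im (u d) @[d --> \oo] --> y by [].
exists (maxn N1 N2) => d; rewrite geq_max => /andP[d1 d2].
apply: le_lt_trans (nrm_le_ReIm _) _; rewrite !raddfB /= [ltRHS]splitr.
by apply: ltrD; [apply: HN1|apply: HN2].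
Qed.

(** Converse of the Cauchy estimates. The radius [1 / (4 c)] makes the tails, of ratio [2 c rho],
    decay at least like powers of [2^-1]. *)
Lemma coef_bound_geo n A c (a : 'X_{1..n} -> C) :
  0 <= A -> 0 < c -> coef_bound A c a ->
  exists f, geo (A * 2 ^+ n) (4 * c) f a.
Proof.
move=> A0 c0 aAc; have c0' := ltW c0; pose r := (4 * c)^-1.
have c40 : 0 < 4 * c by rewrite mulr_gt0.
have r0 : 0 <= r by rewrite invr_ge0 ltW.
have half1 : (2^-1 : C) <= 1 by rewrite invf_le1 ?ler1n.
have twice rho : 2 * c * rho = 4 * c * rho * 2^-1.
  by rewrite (_ : 4 = 2 * 2 :> C) -?natrM //; field.
have tail rho (z : 'cV[C]_n) d e : 0 <= rho -> 4 * c * rho <= 1 -> box rho (z^~ 0) ->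
    (d <= e)%N ->
    `|(ps_trunc e a).@[z^~ 0] - (ps_trunc d a).@[z^~ 0]| <= A * 2 ^+ n * (2 * c * rho) ^+ d.
  move=> rho0 cr bz de; apply: ps_trunc_tail => //.
  by rewrite twice; apply: le_trans half1; rewrite ler_piMl ?invr_ge0.
(* Stating the limit under the condition [box r] lets choice produce a total function, arbitrary
   outside the polydisc. *)
have lim_ex (z : 'cV[C]_n) : exists l : C, box r (z^~ 0) ->
    forall eps : R, 0 < eps -> exists N, forall d, (N <= d)%N ->
    nrm (l - (ps_trunc d a).@[z^~ 0]) < eps.
  have [bz|nbz] := pselect (box r (z^~ 0)); last by exists 0.
  have [l Hl] : exists l : C, forall eps : R, 0 < eps -> exists N, forall d, (N <= d)%N ->
      nrm (l - (ps_trunc d a).@[z^~ 0]) < eps.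
    apply: (@complex_geometric_cvg _ (nrm (A * 2 ^+ n))) => d e de.
    have h : rc (2^-1 : R) = 2^-1 by rewrite rcV rcE rmorph_nat.
    rewrite -rc_le rcM -!nrmE rcX h [`|A * _|]ger0_norm ?mulr_ge0 ?exprn_ge0 //.
    have cr : 4 * c * r = 1 by rewrite divff // gt_eqF.
    apply: le_trans (tail r z d e r0 _ bz de) _; rewrite ?cr //.
    by rewrite twice cr mul1r.
  by exists l.
have /choice [f Hf] := lim_ex.
exists f; split=> [||Q|rho z d rho0 cr bz].
- by rewrite mulr_ge0 ?exprn_ge0.
- by [].
- apply: le_trans (aAc Q) _; rewrite -mulrA ler_wpM2l //.
  rewrite -[leLHS]mul1r; apply: ler_pM; rewrite ?exprn_ge0 //.
    by rewrite exprn_ege1 // ler1n.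
  by rewrite lerXn2r ?nnegrE ?(ltW c40) // ler_peMl // ler1n.
have rho_r : rho <= r by rewrite -[leRHS]mul1r ler_pdivlMr // mulrC.
have br : box r (z^~ 0) by move=> i; apply: le_trans (bz i) rho_r.
apply: (@le_trans _ _ (A * 2 ^+ n * (2 * c * rho) ^+ d)); last first.
  rewrite ler_wpM2l ?mulr_ge0 ?exprn_ge0 // lerXn2r ?nnegrE ?mulr_ge0 //.
  by rewrite !ler_wpM2r // ler_nat.
apply/ler_addgt0Pr => e e0.
have ne0 : 0 < nrm e by rewrite nrm_gt0 gt_eqF.
have [N HN] := Hf z br _ ne0; pose M := maxn d N.
rewrite -(subrK (ps_trunc M a).@[z^~ 0] (f z)) -addrA addrC.
apply: le_trans (ler_normD _ _) (lerD _ _); last first.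
  by rewrite -[e]gtr0_norm // !nrmE rc_le ltW // HN // leq_maxr.
by apply: tail => //; apply: leq_maxl.
Qed.

Lemma coef_bound_vgeo n A c (a : 'I_n -> 'X_{1..n} -> C) :
  0 <= A -> 0 < c -> (forall k, coef_bound A c (a k)) ->
  exists f, vgeo (A * 2 ^+ n) (4 * c) f a.
Proof.
move=> A0 c0 aAc.
have /choice [f Hf] := fun k => coef_bound_geo A0 c0 (aAc k).
exists (fun z => \col_k f k z); split=> [||k].
- by rewrite mulr_ge0 ?exprn_ge0.
- by rewrite mulr_gt0.
by apply: geo_eq_fun (Hf k) _ _ => // z; rewrite mxE.
Qed.

End Completeness.

(** * Convergence of the linearization *)

Section CoefficientBounds.
Variables (K : numFieldType) (n : nat).
Implicit Types (P Q : 'X_{1..n}) (a f g psi : 'I_n -> 'X_{1..n} -> K).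

Definition nonlinear_part a k P : K := if (mdeg P < 2)%N then 0 else a k P.

Lemma fcomp_nonlinear a psi k Q : fmap0 a -> fmap0 psi ->
  fcomp a psi k Q = \sum_j a k U_(j)%MM * psi j Q + fcomp (nonlinear_part a) psi k Q.
Proof.
move=> a0 psi0; pose A := \matrix_(i, j) a i U_(j)%MM.
have -> : \sum_j a k U_(j)%MM * psi j Q = fcomp (flin A) psi k Q.
  by rewrite fcompE_lin //; apply: eq_bigr => j _; rewrite mxE.
rewrite /fcomp -raddfD /= -comp_mpolyD; congr ((_ \mPo _)@__).
rewrite /ps_trunc -big_split; apply: eq_bigr => P _ /=.
rewrite -scalerDl /nonlinear_part; case: ifP => P2.
  by rewrite addr0 -flin_deg1.
by rewrite flin_ge2 ?add0r //; case: (mdeg P) P2 => [|[|]].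
Qed.

Definition analytic_coef psi := exists A c : K,
  [/\ 0 <= A, 0 < c & forall k, coef_bound A c (psi k)].

Lemma recursion_coef_bound (E e : 'X_{1..n} -> K) (G A c : K) psi :
  (forall Q, 0 < E Q) -> E 0%MM = 1 -> (forall l, E U_(l)%MM = 1) ->
  (forall Q, 1 <= e Q) ->
  (forall P Q, P != 0%MM -> Q != 0%MM -> e (P + Q)%MM * (E P * E Q) <= E (P + Q)%MM) ->
  0 < G -> (forall Q, E Q <= G ^+ mdeg Q) -> 0 <= A -> 0 <= c ->
  fmap0 psi -> (forall s l, psi s U_(l)%MM = (s == l)%:R) ->
  (forall s Q, (2 <= mdeg Q)%N -> exists a, (forall k, coef_bound A c (a k)) /\
     `|psi s Q| <= e Q * `|fcomp (nonlinear_part a) psi s Q|) ->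
  analytic_coef psi.
Proof.
move=> Epos E0 E1 e1 Emul G0 EG A0 c0 psi0 psi1 rec.
(* A single constant replaces amplitude and ratio: [A * c ^+ p <= d ^+ p.-1] for [p >= 2], since
   then [1 <= p - 1] and [p <= 2 (p - 1)]. *)
pose d := (1 + A) * (1 + c) ^+ 2.
have A1 : 1 <= 1 + A by rewrite lerDl.
have c1 : 1 <= 1 + c by rewrite lerDl.
have d0 : 0 < d by rewrite mulr_gt0 ?exprn_gt0 // (lt_le_trans ltr01).
have A_d p : (2 <= p)%N -> A * c ^+ p <= d ^+ p.-1.
  move=> p2; rewrite exprMn -exprM.
  have A10 : 0 <= 1 + A by apply: le_trans A1.
  have c10 : 0 <= 1 + c by apply: le_trans c1.
  apply: ler_pM; rewrite ?exprn_ge0 //.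
    apply: (@le_trans _ _ (1 + A)); first by rewrite lerDr.
    have -> : p.-1 = p.-2.+1 by lia.
    by rewrite exprS ler_peMr // exprn_ege1.
  apply: (@le_trans _ _ ((1 + c) ^+ p)).
    by rewrite lerXn2r ?nnegrE // lerDr.
  by rewrite ler_weXn2l //; lia.
pose r := (16 * 2 ^+ n * d)^-1.
have D0 : 0 < 16 * 2 ^+ n * d by rewrite mulr_gt0 // mulr_gt0 // exprn_gt0.
have r0 : 0 < r by rewrite invr_gt0.
have rsmall : 16 * 2 ^+ n * d * r <= 1 by rewrite divff // gt_eqF.
exists (2 * r), (G / r); split=> [||s Q]; first by rewrite mulr_ge0 ?(ltW r0).
  by rewrite divr_gt0.
have rec1 s1 Q1 : (2 <= mdeg Q1)%N -> exists h : 'I_n -> 'X_{1..n} -> K,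
    (forall P, `|h s1 P| <= if (2 <= mdeg P)%N then d ^+ (mdeg P).-1 else 0) /\
    `|psi s1 Q1| <= e Q1 * `|fcomp h psi s1 Q1|.
  move=> Q2; have [a [aAc le1]] := rec s1 Q1 Q2; exists (nonlinear_part a); split=> // P.
  rewrite /nonlinear_part; case: (ltnP (mdeg P) 2) => P2; first by rewrite normr0.
  exact: le_trans (aAc s1 P) (A_d _ P2).
apply: le_trans (recursion_bound Epos E0 e1 Emul d0 r0 rsmall E1 psi0 psi1 rec1 s Q) _.
rewrite exprMn mulrCA ler_wpM2l ?mulr_ge0 ?(ltW r0) //.
by rewrite ler_wpM2r // exprn_ge0 // invr_ge0 ltW.
Qed.

(** In degree at least 2, [Psi o Phi = id] says that [Phi] is minus the nonlinear part of [Psi]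
    evaluated at [Phi], a recursion with all weights equal to 1. *)
Lemma inverse_analytic_coef Psi Phi : analytic_coef Psi ->
  fmap0 Psi -> (forall s l, Psi s U_(l)%MM = (s == l)%:R) ->
  fmap0 Phi -> (forall s l, Phi s U_(l)%MM = (s == l)%:R) ->
  fcomp Psi Phi =2 flin 1%:M -> analytic_coef Phi.
Proof.
move=> [A [c [A0 c0 PsiAc]]] Psi0 Psi1 Phi0 Phi1 inv.
apply: (@recursion_coef_bound (fun=> 1) (fun=> 1) 1 A c) => //; rewrite ?ltW //.
- by move=> Q; rewrite expr1n.
move=> s Q Q2; exists Psi; split=> //; rewrite mul1r.
have := inv s Q; rewrite fcomp_nonlinear // flin_ge2; last by case: (mdeg Q) Q2 => [|[|]].
rewrite (bigD1 s) //= Psi1 eqxx mul1r big1 ?addr0 => [|j js]; last first.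
  by rewrite Psi1 eq_sym (negPf js) mul0r.
by move/eqP; rewrite addr_eq0 => /eqP ->; rewrite normrN.
Qed.

Lemma tangent_inverse (Phi Psi : 'I_n -> 'X_{1..n} -> K) : tangent_to_id Phi -> fmap0 Psi ->
  fcomp Psi Phi =2 flin 1%:M -> forall s l, Psi s U_(l)%MM = (s == l)%:R.
Proof.
move=> [Phi0 Phi1] Psi0 inv s l; have := inv s U_(l)%MM.
rewrite fcomp_coef1 // flin1 mxE (bigD1 l) //= Phi1 eqxx mulr1.
by rewrite big1 ?addr0 // => j jl; rewrite Phi1 (negPf jl) mulr0.
Qed.

End CoefficientBounds.

(** * Siegel's recursion and non-resonance for the family *)

Section Linearizer.
Variables (R : realType) (m n : nat) (mu : 'I_m -> 'I_m -> 'rV[Cx R]_n).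
Notation C := (Cx R).
Implicit Types (P Q : 'X_{1..n}).

Lemma linearizer_analytic_coef (a : 'I_m -> 'I_m -> 'I_n -> 'X_{1..n} -> C)
    (Psi : 'I_n -> 'X_{1..n} -> C) (A c : C) :
  (forall i j s, mu i j 0 s != 0) ->
  (forall Q s, (2 <= mdeg Q)%N -> exists i j, mmap1 (mu i j 0) Q != mu i j 0 s) ->
  diophantine mu -> 0 <= A -> 0 <= c ->
  (forall i j k, coef_bound A c (a i j k)) -> (forall i j, fmap0 (a i j)) ->
  fmap0 Psi -> (forall s l, Psi s U_(l)%MM = (s == l)%:R) ->
  (forall i j, fcomp (a i j) Psi =2 fcomp Psi (flin (diag_mx (mu i j)))) ->
  analytic_coef Psi.
Proof.
move=> mu0 nonres dioph A0 c0 aAc a0 Psi0 Psi1 conj.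
have [E [e [G [Epos E0 E1 e1 [Emul G0 EG div]]]]] := small_divisor_weight mu0 nonres dioph.
apply: (recursion_coef_bound Epos E0 E1 e1 Emul G0 EG A0 c0 Psi0 Psi1) => s Q Q2.
have [i [j [dne0 dle]]] := div Q s Q2.
exists (a i j); split=> //.
(* The degree-one coefficients of the conjugacy show that the linear part of [a i j] is diagonal. *)
have a1 l : a i j s U_(l)%MM = (s == l)%:R * mu i j 0 s.
  have := conj i j s U_(l)%MM; rewrite fcomp_diag mmap1U Psi1 fcomp_coef1 //.
  rewrite (bigD1 l) //= Psi1 eqxx mulr1 big1 ?addr0 => [|k kl].
    by move=> ->; case: eqP => [->|]; rewrite ?mul0r.
  by rewrite Psi1 (negPf kl) mulr0.
have := conj i j s Q; rewrite fcomp_diag fcomp_nonlinear //.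
rewrite (bigD1 s) //= a1 eqxx mul1r big1 ?addr0 => [|k ks]; last first.
  by rewrite a1 eq_sym (negPf ks) !mul0r.
move=> eq1; set N := fcomp _ _ s Q in eq1 *.
have -> : Psi s Q = (mmap1 (mu i j 0) Q - mu i j 0 s)^-1 * N.
  apply: (mulfI dne0); rewrite mulVKf //.
  by rewrite mulrBl [_ * Psi s Q]mulrC -eq1 addrC addKr.
by rewrite normrM normfV ler_wpM2r.
Qed.

Variables (B : 'I_m -> 'M[C]_n) (D : 'I_m -> 'I_m -> 'M[C]_n).
Hypothesis DE : forall i j, D i j = B i *m map_mx Num.conj (B j).
Hypothesis B_unit : forall i, B i \in unitmx.
Hypothesis B_inv : forall i, B i *m map_mx Num.conj (B i) = 1%:M.
Hypothesis D_diag : forall i j, D i j = diag_mx (mu i j).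

Lemma conjB_inv i : map_mx Num.conj (B i) *m B i = 1%:M.
Proof. exact: mulmx1C. Qed.

Lemma mu_inv i j s : mu i j 0 s * mu j i 0 s = 1.
Proof.
have : D i j *m D j i = 1%:M.
  by rewrite !DE mulmxA -[B i *m _ *m B j]mulmxA conjB_inv mulmx1 B_inv.
rewrite !D_diag mulmx_diag => /matrixP/(_ s s).
by rewrite !mxE eqxx !mulr1n.
Qed.

Lemma mu_neq0 i j s : mu i j 0 s != 0.
Proof.
by apply/eqP => mu0; have /eqP := mu_inv i j s; rewrite mu0 mul0r eq_sym oner_eq0.
Qed.

(** As [det (B i0)] is nonzero, some permutation [sigma] picks only nonzero entries of [B i0].
    Comparing these entries in [D j i0 *m B i0 = B i0 *m conj (D i0 j)] gives
    [mu j i0 k = conj (mu i0 j (sigma k))], so a resonance at [s = sigma k] becomes one excluded by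
    [nonresonant] at [k]. *)
Lemma nonresonant_family (i0 : 'I_m) : nonresonant mu ->
  forall Q s, (2 <= mdeg Q)%N -> exists i j, mmap1 (mu i j 0) Q != mu i j 0 s.
Proof.
move=> nonres Q s Q2.
have [sigma Bsigma] : exists sigma : {perm 'I_n}, forall k, B i0 k (sigma k) != 0.
  apply: contrapT => H; have := B_unit i0; rewrite unitmxE unitfE => /eqP; apply.
  rewrite /determinant big1 // => sigma _.
  suff [k Bk] : exists k, B i0 k (sigma k) = 0 by rewrite (bigD1 k) //= Bk mul0r mulr0.
  apply: contrapT => H1; apply: H; exists sigma => k.
  by apply/eqP => Bk; apply: H1; exists k.
have mu_conj j k : mu j i0 0 k = (mu i0 j 0 (sigma k))^*.
  have : D j i0 *m B i0 = B i0 *m map_mx Num.conj (D i0 j).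
    rewrite !DE -mulmxA conjB_inv mulmx1 map_mxM mulmxA B_inv mul1mx.
    by rewrite -map_mx_comp; apply/matrixP => i l; rewrite !mxE /= conjCK.
  rewrite !D_diag map_diag_mx mul_diag_mx mul_mx_diag => /matrixP/(_ k (sigma k)).
  by rewrite !mxE mulrC => /(mulfI (Bsigma k)).
have [k sk] : exists k, sigma k = s by have [g _ gK] := injF_bij (@perm_inj _ sigma); exists (g s); rewrite gK.
have [j muj] := nonres i0 k Q Q2; exists i0, j.
apply: contra muj => /eqP ->; rewrite -{1}sk -mu_conj.
by rewrite -[_^-1]mulr1 -(mu_inv i0 j k) mulKf ?mu_neq0.
Qed.

End Linearizer.

(** * Vector-valued germs and their coefficients *)

Section VectorGerms.
Variables (K : numFieldType) (n : nat).
Implicit Types (f g : 'cV[K]_n -> 'cV[K]_n) (a b : 'I_n -> 'X_{1..n} -> K).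

Lemma vgeo_inj A c B e f g a b : vgeo A c f a -> vgeo B e g b -> germ_eq f g ->
  a =2 b.
Proof.
move=> [_ _ fa] [_ _ gb] fg k; apply: geo_inj (fa k) (gb k) _.
by apply: filterS fg => z ->.
Qed.

Lemma vgeoD A c B e f g a b : vgeo A c f a -> vgeo B e g b ->
  exists A1 c1, vgeo A1 c1 (fun z => f z + g z) (fun k Q => a k Q + b k Q).
Proof.
move=> [A0 c0 fa] [B0 e0 gb]; exists (A + B + (A + B)), (c + e).
split=> [||k]; [by rewrite !addr_ge0|by rewrite addr_gt0|].
have fk : geo (A + B) (c + e) (fun z => f z k 0) (a k).
  by apply: geo_le (fa k); rewrite lerDl // ltW.
have gk : geo (A + B) (c + e) (fun z => g z k 0) (b k).
  by apply: geo_le (gb k); rewrite lerDr // ltW.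
by apply: geo_eq_fun (geoD fk gk) _ _ => // z; rewrite mxE.
Qed.

Lemma fmap0_vgeo A c f a : vgeo A c f a -> f 0 = 0 -> fmap0 a.
Proof. by move=> [_ _ fa] f0 k; rewrite -(geo_near0 (fa k)) f0 mxE. Qed.

Lemma vgeo_at0 A c f a : vgeo A c f a -> fmap0 a -> f 0 = 0.
Proof.
move=> [_ _ fa] a0; apply/matrixP => k j.
by rewrite (ord1 j) (geo_near0 (fa k)) a0 mxE.
Qed.

Hypothesis half_small : forall e : K, 0 < e -> exists N, (2^-1 : K) ^+ N < e.

Lemma vgeo_germ_id A c f a : vgeo A c f a -> a =2 flin 1%:M -> germ_eq f id.
Proof.
move=> fa a1; apply: filterS (vgeo_germ_eq half_small fa (vgeo_linear 1%:M) a1).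
by move=> z ->; rewrite mul1mx.
Qed.

End VectorGerms.

(** * Linearization of the involutions *)

Section Main.
Variables (R : realType) (n : nat).
Notation C := (Cx R).
Implicit Types (z w : 'cV[C]_n) (Q : 'X_{1..n}).

(** The map [z |-> B conj z] is antilinear: if it fixes [z], it sends ['i z] to [- 'i z], and fixing
    ['i z] as well forces [z = 0]. *)
Lemma linear_fix_totally_real (B : 'M[C]_n) : totally_real_subspace (linear_fix B).
Proof.
split=> [|t u v uB vB|z zB izB].
- by rewrite /linear_fix /= /conjv map_mx0 mulmx0.
- rewrite /linear_fix /= /conjv map_mxD map_mxZ mulmxDr -scalemxAr.
  move: uB vB; rewrite /linear_fix /= /conjv => -> ->.
  have -> : (t%:C)%C^* = (t%:C)%C :> C by rewrite conj_Creal // complex_real.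
  by [].
move: zB izB; rewrite /linear_fix /= /conjv map_mxZ -scalemxAr => ->.
rewrite [X in X *: z = _](_ : _ = - 'i); last exact: conjCi.
move=> /eqP; rewrite scaleNr eq_sym -addr_eq0 -scalerDl => /eqP/matrixP z0.
apply/matrixP => k j; have /eqP := z0 k j; rewrite !mxE mulf_eq0 => /orP[|/eqP //].
by rewrite -mulr2n mulrn_eq0 /= (negPf (neq0Ci _)).
Qed.

(** Involutivity gives [rho_i o F_ij = rho_j = F_ji o rho_i]. Read in the linearizing coordinates,
    these are [LD] and [DL]; equating coefficients gives [conj (mu_ij^Q) b = mu_ji,k b]. As
    [mu_ji,k] is the inverse of [mu_ij,k], this is the equality excluded by [nonresonant] for some
    [j]. *)
Lemma involutions_linearized m (B : 'I_m -> 'M[C]_n)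
    (rho : 'I_m -> 'cV[C]_n -> 'cV[C]_n) (S : 'I_m -> 'cV[C]_n -> 'cV[C]_n)
    (mu : 'I_m -> 'I_m -> 'rV[C]_n) (Phi Psi : 'cV[C]_n -> 'cV[C]_n)
    (phi psi : 'I_n -> 'X_{1..n} -> C) (s : 'I_m -> 'I_n -> 'X_{1..n} -> C)
    (A c A1 c1 : C) :
  (forall i z, rho i z = S i (conjv z)) ->
  (forall i, germ_eq (rho i \o rho i) id) ->
  (forall i, exists A c, vgeo A c (S i) (s i)) -> (forall i, fmap0 (s i)) ->
  (forall i k l, s i k U_(l)%MM = B i k l) ->
  (forall i j k, mu i j 0 k * mu j i 0 k = 1) -> nonresonant mu ->
  vgeo A c Phi phi -> fmap0 phi -> (forall k l, phi k U_(l)%MM = (k == l)%:R) ->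
  vgeo A1 c1 Psi psi -> fmap0 psi -> (forall k l, psi k U_(l)%MM = (k == l)%:R) ->
  (forall i j, germ_eq (rho i \o rho j \o Psi) (Psi \o mulmx (diag_mx (mu i j)))) ->
  (forall i j, germ_eq (Phi \o (rho i \o rho j)) (mulmx (diag_mx (mu i j)) \o Phi)) ->
  forall i, germ_eq (Phi \o rho i \o Psi) (fun w => B i *m conjv w).
Proof.
move=> rhoE rho_inv Sgeo s0 s1 mu_inv nonres gPhi phi0 phi1 gPsi psi0 psi1 FPsi PhiF.
have near_Psi (P : 'cV[C]_n -> Prop) : (\forall z \near (0 : 'cV[C]_n), P z) ->
    \forall z \near (0 : 'cV[C]_n), P (Psi z).
  exact: vgeo_continuous0 gPsi psi0 P.
have near_rho i (P : 'cV[C]_n -> Prop) : (\forall z \near (0 : 'cV[C]_n), P z) ->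
    \forall z \near (0 : 'cV[C]_n), P (rho i z).
  move=> nP; have [A2 [c2 gS]] := Sgeo i.
  apply: filterS (near0_conjv (vgeo_continuous0 gS (s0 i) nP)) => z.
  by rewrite rhoE.
(* The inner conjugation makes the map holomorphic, with series [phi o s_i o conj(psi)] and linear
   part [B i]. *)
pose L i w := Phi (rho i (Psi (conjv w))).
pose psic k Q := (psi k Q)^*.
have psic0 : fmap0 psic by move=> k; rewrite /psic psi0 conjC0.
have [b [b0 bL b1]] : exists b : 'I_m -> 'I_n -> 'X_{1..n} -> C,
    [/\ forall i, fmap0 (b i), forall i, exists A c, vgeo A c (L i) (b i) &
        forall i k l, b i k U_(l)%MM = B i k l].
  exists (fun i => fcomp phi (fcomp (s i) psic)); split=> [i|i|i k l].
  - by apply: fmap0_fcomp phi0 _; apply: fmap0_fcomp.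
  - have [A2 [c2 gS]] := Sgeo i.
    have [A3 [c3 g3]] := vgeo_comp gS (vgeo_conj gPsi) psic0.
    have [A4 [c4 g4]] := vgeo_comp gPhi g3 (fmap0_fcomp (s0 i) psic0).
    exists A4, c4; move: g4; congr (vgeo _ _ _ _).
    by apply/funext => w; rewrite /L rhoE.
  rewrite fcomp_coef1 //; last exact: fmap0_fcomp.
  rewrite (bigD1 k) //= phi1 eqxx mul1r big1 ?addr0 => [|j jk]; last first.
    by rewrite phi1 eq_sym (negPf jk) mul0r.
  rewrite fcomp_coef1 // (bigD1 l) //= /psic psi1 eqxx conjC1 mulr1 s1.
  by rewrite big1 ?addr0 // => j jl; rewrite psi1 (negPf jl) conjC0 mulr0.
have LD i j : germ_eq (L i \o mulmx (diag_mx (map_mx Num.conj (mu i j)))) (L j).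
  have nF := near0_conjv (FPsi i j).
  have nr := near0_conjv (near_Psi _ (near_rho j _ (rho_inv i))).
  apply: filterS2 nF nr => w Fw rw; rewrite /= /L.
  rewrite -map_diag_mx conjv_mul -map_mx_comp.
  rewrite (_ : map_mx _ (diag_mx (mu i j)) = diag_mx (mu i j)); last first.
    by apply/matrixP => k l; rewrite [LHS]mxE /= conjCK.
  by move: Fw; rewrite /= => <-; congr Phi.
have DL i j : germ_eq (mulmx (diag_mx (mu j i)) \o L i) (L j).
  have nF := near0_conjv (near_Psi _ (near_rho i _ (PhiF j i))).
  have nr := near0_conjv (near_Psi _ (rho_inv i)).
  apply: filterS2 nF nr => w /= Fw rw; rewrite /L -Fw.
  by congr (Phi (rho j _)).
have b_ge2 i k Q : (2 <= mdeg Q)%N -> b i k Q = 0.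
  move=> Q2; have [j res] := nonres i k Q Q2.
  have [A2 [c2 gi]] := bL i; have [A3 [c3 gj]] := bL j.
  have [A4 [c4 g4]] := vgeo_comp gi
    (vgeo_linear (diag_mx (map_mx Num.conj (mu i j)))) (fmap0_flin _).
  have [A5 [c5 g5]] := vgeo_comp (vgeo_linear (diag_mx (mu j i))) gi (b0 i).
  have e1 := vgeo_inj g4 gj (LD i j) k Q.
  have e2 := vgeo_inj g5 gj (DL i j) k Q.
  rewrite [LHS]fcomp_diag in e1; rewrite [LHS]fcompE_lin // in e2.
  have : b i k Q * mmap1 (map_mx Num.conj (mu i j) 0) Q = mu j i 0 k * b i k Q.
    rewrite e1 -e2 (bigD1 k) //= mxE eqxx mulr1n big1 ?addr0 // => l lk.
    by rewrite mxE eq_sym (negPf lk) mulr0n mul0r.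
  rewrite (_ : mmap1 _ Q = (mmap1 (mu i j 0) Q)^*); last first.
    by rewrite conj_mmap1; apply: eq_bigr => l _; rewrite mxE.
  rewrite (_ : mu j i 0 k = (mu i j 0 k)^-1); last first.
    have mu0 : mu i j 0 k != 0.
      by apply/eqP => m0; have /eqP := mu_inv i j k; rewrite m0 mul0r eq_sym oner_eq0.
    by rewrite -[RHS]mulr1 -(mu_inv i j k) mulKf.
  rewrite mulrC => /eqP; rewrite -subr_eq0 -mulrBl mulf_eq0 subr_eq0 (negPf res).
  by move/eqP.
move=> i; have [A2 [c2 gi]] := bL i.
have bB : b i =2 flin (B i).
  move=> k Q; have [Q2|Q2] := ltnP (mdeg Q) 2; last first.
    by rewrite b_ge2 // flin_ge2 //; case: (mdeg Q) Q2 => [|[|]].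
  rewrite flin_deg1 //; congr (flin _ k Q).
  by apply/matrixP => l j; rewrite mxE b1.
have := near0_conjv (vgeo_germ_eq (@half_small R) gi (vgeo_linear (B i)) bB).
by apply: filterS => w; rewrite /L /= conjvK.
Qed.

End Main.

Unset Implicit Arguments.
Set Strict Implicit.
Set Printing Implicit Defensive.

Theorem corollary3p2 (R : realType) (m n : nat)
  (M : 'I_m -> set 'cV[Cx R]_n)
  (B : 'I_m -> 'M[Cx R]_n)
  (H : 'I_m -> 'cV[Cx R]_n -> 'cV[Cx R]_n)
  (rho : 'I_m -> 'cV[Cx R]_n -> 'cV[Cx R]_n)
  (F : 'I_m -> 'I_m -> 'cV[Cx R]_n -> 'cV[Cx R]_n)
  (D : 'I_m -> 'I_m -> 'M[Cx R]_n)
  (mu : 'I_m -> 'I_m -> 'rV[Cx R]_n)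
  (rhoE : forall i z, rho i z = antiholo_map (B i) (H i) z)
  (FE : forall i j, F i j = rho i \o rho j)
  (DE : forall i j, D i j = B i *m map_mx Num.conj (B j))
  (H_holo : forall i, analytic_germ (H i))
  (H_0 : forall i, H i 0 = 0)
  (H_d0 : forall i, is_diff (0 : 'cV[Cx R]_n) (H i) (fun=> 0))
  (B_unit : forall i, B i \in unitmx)
  (B_inv : forall i, B i *m map_mx Num.conj (B i) = 1%:M)
  (rho_inv : forall i, germ_eq (rho i \o rho i) id)
  (M_fix : forall i, \forall z \near (0 : 'cV[Cx R]_n), M i z <-> rho i z = z)
  (M_mfd : forall i, totally_real_submanifold (M i) (linear_fix (B i)))
  (M_tangent : forall i j, i != j -> linear_fix (B i) <> linear_fix (B j))
  (G_abelian : abelian_germs (generated_group F))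
  (D_diag : forall i j, D i j = diag_mx (mu i j))
  (M_nonres : nonresonant mu)
  (G_lin : formally_linearizable F D)
  (D_dioph : diophantine mu) :
  exists Phi Psi : 'cV[Cx R]_n -> 'cV[Cx R]_n,
    [/\ analytic_germ Phi /\ analytic_germ Psi,
        Phi 0 = 0 /\ Psi 0 = 0,
        inverse_germs Phi Psi &
        forall i,
          totally_real_subspace (linear_fix (B i)) /\
          \forall w \near (0 : 'cV[Cx R]_n),
            M i (Psi w) <-> linear_fix (B i) w].
Proof.
have hs := @half_small R.
(* For [m = 0] the identity coordinates do; otherwise [i0] is the index from which non-resonance of
   the whole family is drawn. *)
have [[i0 _]|no_i] := pselect (exists i : 'I_m, True); last first.
  have an := vgeo_analytic hs (vgeo_linear (1%:M : 'M[Cx R]_n)).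
  exists (mulmx 1%:M), (mulmx 1%:M); split=> [//||| i]; last by case: no_i; exists i.
    by rewrite !mulmx0.
  by split; apply/near0_boxP; exists 1 => // z _ /=; rewrite !mul1mx.
have mu_inv := mu_inv DE B_inv D_diag.
have mu0 := mu_neq0 DE B_inv D_diag.
have nonres := nonresonant_family DE B_unit B_inv D_diag i0 M_nonres.
have [phi [psi [[phi0 phi1] psi0 phipsi psiphi lin]]] := G_lin.
have psi1 := tangent_inverse (conj phi0 phi1) psi0 psiphi.
have /choice [a' Ha'] : forall p : 'I_m * 'I_m, exists a,
    taylor_series (F p.1 p.2) a /\ fcomp (fcomp phi a) psi =2 flin (D p.1 p.2).
  by move=> p; have [a ? ?] := lin p.1 p.2; exists a.
pose a i j := a' (i, j).
have Fa i j : taylor_series (F i j) (a i j) := (Ha' (i, j)).1.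
have linF i j : fcomp (fcomp phi (a i j)) psi =2 flin (D i j) := (Ha' (i, j)).2.
have rho0 i : rho i 0 = 0 by rewrite rhoE /antiholo_map /conjv map_mx0 mulmx0 H_0 addr0.
have F0 i j : F i j 0 = 0 by rewrite FE /= !rho0.
have a0 i j : fmap0 (a i j).
  by have [? [? /fmap0_vgeo]] := taylor_vgeo (Fa i j); apply.
(* Since the pair [(i, j)] chosen in the recursion varies with [Q] and [s], one pair of constants
   must serve all the [F i j]. *)
have [A [c [A0 [c0 Ac]]]] := geo_family
  (f := fun p : 'I_m * 'I_m * 'I_n => fun z => F p.1.1 p.1.2 z p.2 0)
  (fun p => expansion_geo (Fa p.1.1 p.1.2 p.2)).
have aAc i j k : coef_bound A c (a i j k) by have [] := Ac (i, j, k).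
(* Composing [phi o F_ij o psi = D_ij] with [psi] on the left; the equation becomes linear in [psi]
   up to higher-order terms. *)
have conjF i j : fcomp (a i j) psi =2 fcomp psi (flin (diag_mx (mu i j))).
  have ap0 : fmap0 (fcomp (a i j) psi) by apply: fmap0_fcomp.
  move=> k Q; rewrite -D_diag -(fcomp1f ap0) -(eq_fcomp psiphi (fun _ _ => erefl)).
  rewrite (fcompA _ phi0 ap0); apply: eq_fcomp => // k' Q'.
  by rewrite -(fcompA _ (a0 i j) psi0) linF.
have Fphi i j : fcomp phi (a i j) =2 fcomp (flin (diag_mx (mu i j))) phi.
  have pa0 : fmap0 (fcomp phi (a i j)) by apply: fmap0_fcomp.
  move=> k Q; rewrite -D_diag -[RHS](eq_fcomp (linF i j) (fun _ _ => erefl)).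
  rewrite (fcompA _ psi0 phi0) (eq_fcomp (fun _ _ => erefl) psiphi).
  by rewrite fcompf1.
have psi_an := linearizer_analytic_coef mu0 nonres D_dioph A0 (ltW c0) aAc a0 psi0 psi1 conjF.
have phi_an := inverse_analytic_coef psi_an psi0 psi1 phi0 phi1 psiphi.
have [A1 [c1 [A10 c10 /(coef_bound_vgeo A10 c10) [Psi gPsi]]]] := psi_an.
have [A2 [c2 [A20 c20 /(coef_bound_vgeo A20 c20) [Phi gPhi]]]] := phi_an.
have PhiPsi : germ_eq (Phi \o Psi) id.
  by have [? [? g]] := vgeo_comp gPhi gPsi psi0; apply: (vgeo_germ_id hs g).
have PsiPhi : germ_eq (Psi \o Phi) id.
  by have [? [? g]] := vgeo_comp gPsi gPhi phi0; apply: (vgeo_germ_id hs g).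
have FPsi i j : germ_eq (rho i \o rho j \o Psi) (Psi \o mulmx (diag_mx (mu i j))).
  have [? [? gF]] := taylor_vgeo (Fa i j).
  have [? [? g1]] := vgeo_comp gF gPsi psi0.
  have [? [? g2]] := vgeo_comp gPsi (vgeo_linear (diag_mx (mu i j))) (fmap0_flin _).
  by rewrite -FE; apply: (vgeo_germ_eq hs g1 g2).
have PhiF i j : germ_eq (Phi \o (rho i \o rho j)) (mulmx (diag_mx (mu i j)) \o Phi).
  have [? [? gF]] := taylor_vgeo (Fa i j).
  have [? [? g1]] := vgeo_comp gPhi gF (a0 i j).
  have [? [? g2]] := vgeo_comp (vgeo_linear (diag_mx (mu i j))) gPhi phi0.
  by rewrite -FE; apply: (vgeo_germ_eq hs g1 g2).
have /choice [h Hh] := H_holo.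
(* The holomorphic map [S i] with [rho i z = S i (conjv z)]; its linear part is [B i] because the
   differential of [H i] vanishes at 0. *)
pose s i k Q := flin (B i) k Q + h i k Q.
pose S i z := B i *m z + H i z.
have gS i : exists A c, vgeo A c (S i) (s i).
  have [? [? gH]] := taylor_vgeo (Hh i).
  exact: vgeoD (vgeo_linear (B i)) gH.
have h0 i : fmap0 (h i).
  by have [? [? /fmap0_vgeo]] := taylor_vgeo (Hh i); apply.
have s0 i : fmap0 (s i) by move=> k; rewrite /s h0 fmap0_flin addr0.
have s1 i k l : s i k U_(l)%MM = B i k l.
  have [? [? gH]] := taylor_vgeo (Hh i).
  by rewrite /s flin1 (diff0_coef _ _ gH (H_d0 i) (H_0 i)) addr0.
have main := involutions_linearized (rho := rho) (S := S) rhoE rho_inv gS s0 s1 mu_inv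
  M_nonres gPhi phi0 phi1 gPsi psi0 psi1 FPsi PhiF.
exists Phi, Psi; split=> //.
- by split; [apply: vgeo_analytic gPhi|apply: vgeo_analytic gPsi].
- by split; [apply: vgeo_at0 gPhi phi0|apply: vgeo_at0 gPsi psi0].
move=> i; split; first exact: linear_fix_totally_real.
have nM := vgeo_continuous0 gPsi psi0 (M_fix i).
(* Needed for the reverse inclusion: [Phi (rho i (Psi w)) = w] yields [rho i (Psi w) = Psi w] only
   if [Psi o Phi] is the identity at the point [rho i (Psi w)]. *)
have nrho : \forall w \near (0 : 'cV[Cx R]_n), Psi (Phi (rho i (Psi w))) = rho i (Psi w).
  apply: (vgeo_continuous0 gPsi psi0
    (S := fun y => Psi (Phi (rho i y)) = rho i y)).
  have [? [? g]] := gS i.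
  apply: filterS (near0_conjv (vgeo_continuous0 g (s0 i) PsiPhi)) => z.
  by rewrite rhoE.
near=> w.
have -> : M i (Psi w) <-> rho i (Psi w) = Psi w by near: w.
have rw : Psi (Phi (rho i (Psi w))) = rho i (Psi w) by near: w.
have Lw : Phi (rho i (Psi w)) = B i *m conjv w by near: w; apply: main.
have Pw : Phi (Psi w) = w by near: w.
rewrite /linear_fix /= -Lw; split=> [->//|Ew].
by rewrite -rw Ew.
Unshelve. all: by end_near.
Qed.
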